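(* (ZF, without the Axiom of Choice.) The following statements hold: (a) $\omega_2\to(\omega_1)^1_{\omega_1}$; (b) $\omega_2\to(\omega_1,\omega+1)$; (c) $Regressive(\omega_2,\omega_1)$; (d) ${[\omega_2]}^{<\omega}\to\Delta(\omega_1)$.
   Context: The base theory is ZF. Cardinals are initial ordinals. $\omega_2\to(\omega_1)^1_{\omega_1}$ means: for every $f:\omega_2\to\omega_1$ there is a set $H\subset\omega_2$ of cardinality $\omega_1$ on which $f$ is constant. $\omega_2\to(\omega_1,\omega+1)$ means: for every $f:[\omega_2]^2\to 2$ there is either a set $H\subset\omega_2$ of order type $\omega_1$ with $f$ constantly $0$ on $[H]^2$, or a set $H\subset\omega_2$ of order type $\omega+1$ with $f$ constantly $1$ on $[H]^2$. For cardinals $\mu,\lambda\in On$, $Regressive(\mu,\lambda)$ means: for each regressive function $f:\mu\to\mu$ (i.e. $f(\alpha)<\alpha$ for all $0<\alpha<\mu$) there is $\alpha<\mu$ such that $|f^{-1}\{\alpha\}|\ge\lambda$. For infinite cardinals $\mu,\lambda$, ${[\mu]}^{<\omega}\to\Delta(\lambda)$ means: every family $\mathcal A$ of finite sets of ordinals with $|\mathcal A|=\mu$ contains a $\Delta$-system $\mathcal B\subset\mathcal A$ with $|\mathcal B|=\lambda$ (a $\Delta$-system is a family for which there is a set $D$, the kernel, such that $A\cap B=D$ for all distinct members $A,B$). *)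

(* Defs.v *)
(** First-order Zermelo-Fraenkel set theory, without choice.

    A universe is an arbitrary type with a binary relation, and it is a model of
    ZF when it satisfies the usual first-order axioms.  Separation and
    replacement are schemas over the formulas of the language {∈, =} with
    parameters, and not statements about all Rocq predicates: with the latter,
    choice in the metatheory would give choice inside the model.

    All set-theoretic notions below quantify over elements of the universe only,
    so each of them is the satisfaction of a first-order formula; in particular
    finiteness, functions and cardinality are those of the model. *)

Set Implicit Arguments.

Record universe := Universe {
  carrier :> Type;
  mem : carrier -> carrier -> Prop
}.

Arguments mem {u} x y.

Declare Scope zf_scope.
Open Scope zf_scope.

Notation "x ∈ y" := (mem x y) (at level 70, no associativity) : zf_scope.

(** * Formulas and satisfaction *)

(** Variables are de Bruijn indices: a quantifier binds index 0. *)
Inductive formula : Set :=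
| FMem (i j : nat)
| FEq (i j : nat)
| FBot
| FImp (p q : formula)
| FAnd (p q : formula)
| FOr (p q : formula)
| FAll (p : formula)
| FEx (p : formula).

Definition env_cons {T : Type} (x : T) (rho : nat -> T) (n : nat) : T :=
  match n with
  | O => x
  | S k => rho k
  end.

Fixpoint sat {M : universe} (rho : nat -> M) (p : formula) : Prop :=
  match p with
  | FMem i j => rho i ∈ rho j
  | FEq i j => rho i = rho j
  | FBot => False
  | FImp p q => sat rho p -> sat rho q
  | FAnd p q => sat rho p /\ sat rho q
  | FOr p q => sat rho p \/ sat rho q
  | FAll p => forall x : M, sat (env_cons x rho) p
  | FEx p => exists x : M, sat (env_cons x rho) p
  end.

(** * Basic sets *)

Definition is_empty {M : universe} (e : M) : Prop := forall x : M, ~ x ∈ e.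

Definition subset {M : universe} (a b : M) : Prop :=
  forall x : M, x ∈ a -> x ∈ b.

(** [z = {x, y}] *)
Definition is_upair {M : universe} (z x y : M) : Prop :=
  forall u : M, u ∈ z <-> u = x \/ u = y.

(** [s = x ∪ {x}] *)
Definition is_succ {M : universe} (s x : M) : Prop :=
  forall u : M, u ∈ s <-> u ∈ x \/ u = x.

(** [p = (x, y) = {{x}, {x, y}}] *)
Definition is_opair {M : universe} (p x y : M) : Prop :=
  exists s d : M, is_upair s x x /\ is_upair d x y /\ is_upair p s d.

(** * The axioms *)

Record is_ZF_model (M : universe) : Prop := {
  zf_extensionality :
    forall x y : M, (forall z : M, z ∈ x <-> z ∈ y) -> x = y;
  zf_foundation :
    forall x : M, (exists y : M, y ∈ x) ->
      exists y : M, y ∈ x /\ forall z : M, z ∈ y -> ~ z ∈ x;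
  zf_pairing :
    forall x y : M, exists z : M, is_upair z x y;
  zf_union :
    forall x : M, exists u : M,
      forall z : M, z ∈ u <-> exists y : M, y ∈ x /\ z ∈ y;
  zf_powerset :
    forall x : M, exists p : M, forall z : M, z ∈ p <-> subset z x;
  zf_infinity :
    exists i : M,
      (exists e : M, is_empty e /\ e ∈ i) /\
      (forall x : M, x ∈ i -> exists s : M, is_succ s x /\ s ∈ i);
  zf_separation :
    forall (p : formula) (rho : nat -> M) (a : M), exists b : M,
      forall x : M, x ∈ b <-> x ∈ a /\ sat (env_cons x rho) p;
  zf_replacement :
    forall (p : formula) (rho : nat -> M) (a : M),
      (forall x y y' : M, x ∈ a ->
         sat (env_cons x (env_cons y rho)) p ->
         sat (env_cons x (env_cons y' rho)) p -> y = y') ->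
      exists b : M, forall y : M,
        y ∈ b <-> exists x : M, x ∈ a /\ sat (env_cons x (env_cons y rho)) p
}.

(** * Functions *)

(** [f(x) = y], for a function [f] given as a set of ordered pairs *)
Definition app {M : universe} (f x y : M) : Prop :=
  exists p : M, p ∈ f /\ is_opair p x y.

Definition is_function {M : universe} (f a b : M) : Prop :=
  (forall p : M, p ∈ f -> exists x y : M, x ∈ a /\ y ∈ b /\ is_opair p x y) /\
  (forall x : M, x ∈ a -> exists! y : M, app f x y).

Definition is_bijection {M : universe} (f a b : M) : Prop :=
  is_function f a b /\
  (forall x x' y : M, app f x y -> app f x' y -> x = x') /\
  (forall y : M, y ∈ b -> exists x : M, app f x y).

Definition equinumerous {M : universe} (a b : M) : Prop :=
  exists f : M, is_bijection f a b.

(** * Ordinals *)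

Definition is_transitive {M : universe} (a : M) : Prop :=
  forall x : M, x ∈ a -> subset x a.

Definition well_ordered_by_mem {M : universe} (a : M) : Prop :=
  (forall x : M, x ∈ a -> ~ x ∈ x) /\
  (forall x y z : M, x ∈ a -> y ∈ a -> z ∈ a -> x ∈ y -> y ∈ z -> x ∈ z) /\
  (forall x y : M, x ∈ a -> y ∈ a -> x ∈ y \/ x = y \/ y ∈ x) /\
  (forall s : M, subset s a -> (exists x : M, x ∈ s) ->
     exists m : M, m ∈ s /\ forall x : M, x ∈ s -> m = x \/ m ∈ x).

Definition is_ordinal {M : universe} (a : M) : Prop :=
  is_transitive a /\ well_ordered_by_mem a.

Definition is_limit {M : universe} (a : M) : Prop :=
  is_ordinal a /\ ~ is_empty a /\ ~ (exists b : M, is_succ a b).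

(** [w = ω], the least limit ordinal *)
Definition is_omega {M : universe} (w : M) : Prop :=
  is_limit w /\ forall x : M, x ∈ w -> ~ is_limit x.

Definition is_finite {M : universe} (a : M) : Prop :=
  exists w n : M, is_omega w /\ n ∈ w /\ equinumerous a n.

(** The set of ordinals [h], ordered by [∈], has order type [a]. *)
Definition has_order_type {M : universe} (h a : M) : Prop :=
  is_ordinal a /\
  exists f : M, is_bijection f h a /\
    forall x x' y y' : M, app f x y -> app f x' y' -> (x ∈ x' <-> y ∈ y').

(** * Cardinals *)

Definition is_cardinal {M : universe} (k : M) : Prop :=
  is_ordinal k /\ forall b : M, b ∈ k -> ~ equinumerous b k.

(** [|a| = k] *)
Definition has_card {M : universe} (a k : M) : Prop :=
  is_cardinal k /\ equinumerous a k.

(** [l = k^+], the least cardinal greater than [k] *)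
Definition is_next_cardinal {M : universe} (l k : M) : Prop :=
  is_cardinal l /\ k ∈ l /\ forall m : M, m ∈ l -> k ∈ m -> ~ is_cardinal m.

Definition is_omega1 {M : universe} (w1 : M) : Prop :=
  exists w : M, is_omega w /\ is_next_cardinal w1 w.

Definition is_omega2 {M : universe} (w2 : M) : Prop :=
  exists w1 : M, is_omega1 w1 /\ is_next_cardinal w2 w1.

(** * Partition relations *)

(** [k → (l)^1_m] *)
Definition arrow1 {M : universe} (k l m : M) : Prop :=
  forall f : M, is_function f k m ->
    exists h : M, subset h k /\ has_card h l /\
      exists c : M, forall x : M, x ∈ h -> app f x c.

(** [z ∈ [x]^2] *)
Definition is_pair_of {M : universe} (z x : M) : Prop :=
  exists a b : M, a ∈ x /\ b ∈ x /\ a <> b /\ is_upair z a b.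

(** [f] is constantly [c] on [[h]^2]. *)
Definition constant_on_pairs {M : universe} (f h c : M) : Prop :=
  forall z : M, is_pair_of z h -> app f z c.

(** [k → (a, b)], i.e. [k → (a, b)^2]; the colours are [zero = ∅], [one = {∅}],
    and [two = {zero, one}]. *)
Definition arrow2 {M : universe} (k a b : M) : Prop :=
  forall zero one two pairs f : M,
    is_empty zero -> is_succ one zero -> is_succ two one ->
    (forall z : M, z ∈ pairs <-> is_pair_of z k) ->
    is_function f pairs two ->
    (exists h : M, subset h k /\ has_order_type h a /\
       constant_on_pairs f h zero) \/
    (exists h : M, subset h k /\ has_order_type h b /\
       constant_on_pairs f h one).

(** * Regressive functions *)

Definition is_regressive {M : universe} (f k : M) : Prop :=
  is_function f k k /\
  forall a b : M, a ∈ k -> ~ is_empty a -> app f a b -> b ∈ a.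

(** [s = f^{-1}{a}] *)
Definition is_fiber {M : universe} (s f a : M) : Prop :=
  forall x : M, x ∈ s <-> app f x a.

Definition Regressive {M : universe} (k l : M) : Prop :=
  forall f : M, is_regressive f k ->
    exists a s c : M, a ∈ k /\ is_fiber s f a /\ has_card s c /\
      (l ∈ c \/ l = c).

(** * Delta-systems *)

Definition is_delta_system {M : universe} (B : M) : Prop :=
  exists d : M, forall a b : M, a ∈ B -> b ∈ B -> a <> b ->
    forall x : M, x ∈ d <-> x ∈ a /\ x ∈ b.

(** [[k]^{<ω} → Δ(l)] *)
Definition arrow_delta {M : universe} (k l : M) : Prop :=
  forall A : M,
    (forall a : M, a ∈ A ->
       is_finite a /\ forall x : M, x ∈ a -> is_ordinal x) ->
    has_card A k ->
    exists B : M, subset B A /\ is_delta_system B /\ has_card B l.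

(* Main.v *)
(** Without choice, a union of [ω1] many sets of ordinals of order type less
    than [ω1] still has size at most [ω1], because each of them has a canonical
    enumeration and [ω1 × ω1] is covered by [ω1]; hence it cannot exhaust [ω2].
    This gives (a) at once.  In the other parts one forms a set of nodes that is
    closed under a definable operation [F(s, i)], [i < ω1], and still has size at
    most [ω1].  The node [s] carries a definable set [D(s)] of ordinals below
    [ω2] that already has the required property; if all [D(s)] have order type
    less than [ω1], some [ξ < ω2] avoids [D(s)] for all nodes [s].  For (b) and
    (d) this [ξ] yields a canonical [ω]-branch through the nodes, by always
    taking the least possible element.  For (c) the nodes are ordinals below
    [ω2] and [D(s)] is the fiber over [s], so the least ordinal that is not a
    node gives a contradiction. *)

(* Two obstacles shape the proof. In ZF even [ω1] may be singular, so no step may select an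
   enumeration of type [ω] for each of [ω1] many countable sets. Ranks avoid this: a set of ordinals
   of order type below [ω1] hands each of its elements a definable index below [ω1], and one pairing
   function on [ω1] merges two indices into one. The same pairing, chosen so that the first
   coordinate never exceeds the code, arranges the closure under [F] as a single recursion of length
   [ω1]. The second obstacle is that separation and replacement accept formulas only, so each
   operation carries a proof that its graph is definable, and the metatheoretic [epsilon] may name
   an object only when that object is unique. The sets [D(s)] of (b) and (d) are built greedily
   because of what rejection then means: an admissible [ξ] outside [D(s)] conflicts with an earlier
   member of [D(s)]. The conflict supplies the next element of the branch, and as this element is
   read off from an indexed member of [D(s)], the extended node is in the hull again. *)
From Stdlib Require Import Classical ClassicalEpsilon PeanoNat.
Require Import Defs.

(** * Definability by formulas with parameters *)

Section Definability.

Context {M : universe}.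

Notation env := (nat -> M).
Notation shift e := (fun n : nat => e (S n)).

Fixpoint rename (r : nat -> nat) (p : formula) : formula :=
  let up := fun n => match n with O => O | S k => S (r k) end in
  match p with
  | FMem i j => FMem (r i) (r j)
  | FEq i j => FEq (r i) (r j)
  | FBot => FBot
  | FImp p q => FImp (rename r p) (rename r q)
  | FAnd p q => FAnd (rename r p) (rename r q)
  | FOr p q => FOr (rename r p) (rename r q)
  | FAll p => FAll (rename up p)
  | FEx p => FEx (rename up p)
  end.

Lemma sat_rename (p : formula) (r : nat -> nat) (rho rho' : env) :
  (forall n, rho' n = rho (r n)) -> (sat rho (rename r p) <-> sat rho' p).
Proof.
  revert r rho rho'.
  induction p; intros r rho rho' E; simpl; rewrite ?E;
    try (rewrite (IHp1 r rho rho' E), (IHp2 r rho rho' E)); try tauto.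
  - split; intros H x; specialize (H x); eapply IHp; eauto; intros [|n]; simpl; auto.
  - split; intros [x H]; exists x; eapply IHp; eauto; intros [|n]; simpl; auto.
Qed.

Definition lookup (e : env) (s : nat + M) : M :=
  match s with inl k => e k | inr c => c end.

(** A predicate of finitely many variables [e 0, e 1, ...] is definable when it
    is the satisfaction of a formula whose free variables are filled by
    variables [inl k] or by parameters [inr c]. *)
Definition Def (P : env -> Prop) : Prop :=
  exists (q : formula) (f : nat -> nat + M),
    forall e, P e <-> sat (fun n => lookup e (f n)) q.

Definition DefT (t : env -> M) : Prop := Def (fun e => e 0 = t (shift e)).

Lemma Def_iff (P Q : env -> Prop) : (forall e, P e <-> Q e) -> Def P -> Def Q.
Proof.
  intros H (q & f & Hq). exists q, f. intros e. rewrite <- H. apply Hq.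
Qed.

Lemma Def_reindex (P : env -> Prop) (r : nat -> nat + M) :
  Def P -> Def (fun e => P (fun n => lookup e (r n))).
Proof.
  intros (q & f & Hq).
  exists q, (fun n => match f n with inl k => r k | inr c => inr c end).
  intros e. rewrite Hq.
  (* The two environments agree only pointwise. Renaming by the identity lets [sat_rename] absorb
     the difference without functional extensionality. *)
  rewrite <- (sat_rename q (fun n => n)
    (fun n => lookup e (match f n with inl k => r k | inr c => inr c end))).
  - apply sat_rename. intros n; reflexivity.
  - intros n. destruct (f n); reflexivity.
Qed.

(** A compound formula has a single assignment of its free variables. Moving the variables of one
    part to even indices and those of the other to odd indices makes room for both assignments,
    whatever indices occur. *)
Lemma Def_merge (P Q : env -> Prop) :
  Def P -> Def Q ->
  exists (q q' : formula) (f : nat -> nat + M),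
    forall e, (P e <-> sat (fun n => lookup e (f n)) q) /\
              (Q e <-> sat (fun n => lookup e (f n)) q').
Proof.
  intros (p & f & Hp) (q & g & Hq).
  exists (rename (fun n => 2 * n) p), (rename (fun n => S (2 * n)) q),
    (fun n => if Nat.even n then f (Nat.div2 n) else g (Nat.div2 n)).
  intros e. rewrite Hp, Hq. split; symmetry; apply sat_rename; intros n.
  - rewrite Nat.even_even, Nat.div2_double. reflexivity.
  - replace (S (2 * n)) with (2 * n + 1) at 1 by (rewrite Nat.add_1_r; reflexivity).
    rewrite Nat.even_odd, Nat.div2_succ_double. reflexivity.
Qed.

Lemma Def_and P Q : Def P -> Def Q -> Def (fun e => P e /\ Q e).
Proof.
  intros HP HQ. destruct (Def_merge _ _ HP HQ) as (p & q & f & H).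
  exists (FAnd p q), f. intros e. destruct (H e). simpl. tauto.
Qed.

Lemma Def_or P Q : Def P -> Def Q -> Def (fun e => P e \/ Q e).
Proof.
  intros HP HQ. destruct (Def_merge _ _ HP HQ) as (p & q & f & H).
  exists (FOr p q), f. intros e. destruct (H e). simpl. tauto.
Qed.

Lemma Def_imp P Q : Def P -> Def Q -> Def (fun e => P e -> Q e).
Proof.
  intros HP HQ. destruct (Def_merge _ _ HP HQ) as (p & q & f & H).
  exists (FImp p q), f. intros e. destruct (H e). simpl. tauto.
Qed.

Lemma Def_not P : Def P -> Def (fun e => ~ P e).
Proof.
  intros HP. apply (Def_iff (fun e => P e -> False)). { tauto. }
  apply Def_imp; trivial. exists FBot, inl. simpl. tauto.
Qed.

Lemma Def_equiv P Q : Def P -> Def Q -> Def (fun e => P e <-> Q e).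
Proof. intros HP HQ. apply Def_and; apply Def_imp; trivial. Qed.

(** Prepares for binding: several indices of [q] may be assigned the variable 0, and all of them are
    renamed to the single de Bruijn index 0. *)
Lemma Def_body (P : M -> env -> Prop) :
  Def (fun e => P (e 0) (shift e)) ->
  exists (q : formula) (f : nat -> nat + M),
    forall e x, P x e <-> sat (env_cons x (fun n => lookup e (f n))) q.
Proof.
  intros (q & f & H).
  exists (rename (fun n => match f n with inl O => O | _ => S n end) q),
    (fun n => match f n with inl (S k) => inl k | s => s end).
  intros e x. specialize (H (env_cons x e)). simpl in H.
  change (fun n : nat => e n) with e in H. rewrite H.
  symmetry. apply sat_rename. intros n.
  destruct (f n) as [[|k]|c] eqn:E; simpl; rewrite ?E; reflexivity.
Qed.

Lemma Def_body2 (P : M -> M -> env -> Prop) :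
  Def (fun e => P (e 0) (e 1) (shift (shift e))) ->
  exists (q : formula) (f : nat -> nat + M),
    forall e x y, P x y e <-> sat (env_cons x (env_cons y (fun n => lookup e (f n)))) q.
Proof.
  intros (q & f & H).
  exists (rename (fun n => match f n with inl O => O | inl 1 => 1 | _ => S (S n) end) q),
    (fun n => match f n with inl (S (S k)) => inl k | s => s end).
  intros e x y. specialize (H (env_cons x (env_cons y e))). simpl in H.
  change (fun n : nat => e n) with e in H. rewrite H.
  symmetry. apply sat_rename. intros n.
  destruct (f n) as [[|[|k]]|c] eqn:E; simpl; rewrite ?E; reflexivity.
Qed.

Lemma Def_all (P : M -> env -> Prop) :
  Def (fun e => P (e 0) (shift e)) -> Def (fun e => forall x, P x e).
Proof.
  intros H. destruct (Def_body P H) as (q & f & Hq).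
  exists (FAll q), f. intros e. simpl.
  split; intros H1 x; apply Hq; apply H1.
Qed.

Lemma Def_ex (P : M -> env -> Prop) :
  Def (fun e => P (e 0) (shift e)) -> Def (fun e => exists x, P x e).
Proof.
  intros H. destruct (Def_body P H) as (q & f & Hq).
  exists (FEx q), f. intros e. simpl.
  split; intros [x H1]; exists x; apply Hq; apply H1.
Qed.

(** The language has no terms, so substituting [t] means quantifying over a value that satisfies its
    graph. *)
Lemma Def_subst (P : M -> env -> Prop) (t : env -> M) :
  Def (fun e => P (e 0) (shift e)) -> DefT t -> Def (fun e => P (t e) e).
Proof.
  intros HP Ht. apply (Def_iff (fun e => exists x, x = t e /\ P x e)).
  { intros e. split; [intros (x & -> & H) | exists (t e)]; auto. }
  apply Def_ex. apply Def_and; [exact Ht | exact HP].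
Qed.

Lemma Def_drop1 (P : M -> env -> Prop) :
  Def (fun e => P (e 0) (shift e)) -> Def (fun e => P (e 0) (shift (shift e))).
Proof.
  exact (Def_reindex (fun e => P (e 0) (shift e))
    (fun n => match n with O => inl O | S k => inl (S (S k)) end)).
Qed.

Lemma DefT_shift (t : env -> M) : DefT t -> DefT (fun e => t (shift e)).
Proof. exact (Def_drop1 (fun x e => x = t e)). Qed.

Lemma DefT_var (k : nat) : DefT (fun e => e k).
Proof.
  exists (FEq 0 1), (fun n => match n with O => inl O | _ => inl (S k) end).
  simpl. tauto.
Qed.

Lemma DefT_const (c : M) : DefT (fun _ => c).
Proof.
  exists (FEq 0 1), (fun n => match n with O => inl O | _ => inr c end).
  simpl. tauto.
Qed.

Lemma Def_mem (t u : env -> M) : DefT t -> DefT u -> Def (fun e => t e ∈ u e).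
Proof.
  intros Ht Hu. apply (Def_subst (fun x e => x ∈ u e)); trivial.
  apply (Def_subst (fun x e => e 0 ∈ x) (fun e => u (shift e)));
    [|now apply DefT_shift].
  exists (FMem 1 0), inl. simpl. tauto.
Qed.

Lemma Def_eq (t u : env -> M) : DefT t -> DefT u -> Def (fun e => t e = u e).
Proof. intros Ht Hu. exact (Def_subst (fun x e => x = u e) t Hu Ht). Qed.

Lemma Def_app1 (P : M -> Prop) (t : env -> M) :
  Def (fun e => P (e 0)) -> DefT t -> Def (fun e => P (t e)).
Proof. exact (Def_subst (fun x _ => P x) t). Qed.

Lemma Def_app2 (P : M -> M -> Prop) (t u : env -> M) :
  Def (fun e => P (e 0) (e 1)) -> DefT t -> DefT u -> Def (fun e => P (t e) (u e)).
Proof.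
  intros HP Ht Hu. apply (Def_subst (fun x e => P x (u e))); trivial.
  apply (Def_subst (fun y e => P (e 0) y) (fun e => u (shift e)));
    [|now apply DefT_shift].
  exact (Def_reindex _ (fun n => match n with O => inl 1 | _ => inl O end) HP).
Qed.

Lemma Def_app3 (P : M -> M -> M -> Prop) (t u v : env -> M) :
  Def (fun e => P (e 0) (e 1) (e 2)) -> DefT t -> DefT u -> DefT v ->
  Def (fun e => P (t e) (u e) (v e)).
Proof.
  intros HP Ht Hu Hv. apply (Def_subst (fun x e => P x (u e) (v e))); trivial.
  apply (Def_subst (fun y e => P (e 0) y (v (shift e))) (fun e => u (shift e)));
    [|now apply DefT_shift].
  apply (Def_subst (fun z e => P (e 1) (e 0) z) (fun e => v (shift (shift e))));
    [|now apply (DefT_shift (fun e => v (shift e))), DefT_shift].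
  exact (Def_reindex _ (fun n => match n with O => inl 2 | 1 => inl 1 | _ => inl 0 end) HP).
Qed.

Lemma DefT_app1 (F : M -> M) (t : env -> M) :
  DefT (fun e => F (e 0)) -> DefT t -> DefT (fun e => F (t e)).
Proof.
  intros HF Ht.
  exact (Def_app2 (fun y x => y = F x) _ _ HF (DefT_var 0) (DefT_shift _ Ht)).
Qed.

Lemma DefT_app2 (F : M -> M -> M) (t u : env -> M) :
  DefT (fun e => F (e 0) (e 1)) -> DefT t -> DefT u -> DefT (fun e => F (t e) (u e)).
Proof.
  intros HF Ht Hu.
  exact (Def_app3 (fun z x y => z = F x y) _ _ _ HF (DefT_var 0)
           (DefT_shift _ Ht) (DefT_shift _ Hu)).
Qed.

Lemma DefT_subst (F : M -> env -> M) (t : env -> M) :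
  DefT (fun e => F (e 0) (shift e)) -> DefT t -> DefT (fun e => F (t e) e).
Proof.
  intros HF Ht.
  apply (Def_subst (fun x e => e 0 = F x (shift e)) (fun e => t (shift e)));
    [|now apply DefT_shift].
  exact (Def_reindex _
    (fun n => match n with O => inl 1 | 1 => inl 0 | _ => inl n end) HF).
Qed.

Lemma DefT_app3 (F : M -> M -> M -> M) (t u v : env -> M) :
  DefT (fun e => F (e 0) (e 1) (e 2)) -> DefT t -> DefT u -> DefT v ->
  DefT (fun e => F (t e) (u e) (v e)).
Proof.
  intros HF Ht Hu Hv. apply (DefT_subst (fun x e => F x (u e) (v e))); trivial.
  apply (DefT_subst (fun y e => F (e 0) y (v (shift e))) (fun e => u (shift e)));
    [|now apply DefT_shift].
  apply (DefT_subst (fun z e => F (e 1) (e 0) z) (fun e => v (shift (shift e))));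
    [|now apply (DefT_shift (fun e => v (shift e))), DefT_shift].
  exact (Def_reindex _
    (fun n => match n with O => inl 0 | 1 => inl 3 | 2 => inl 2 | _ => inl 1 end) HF).
Qed.

End Definability.

Notation shift e := (fun n : nat => e (S n)).

Ltac def_user := fail.

(** Follows the shape of the Rocq expression: connectives and quantifiers go to the closure lemmas,
    and symbols are looked up among the hypotheses and then among the known definable operations. *)
Ltac def :=
  cbv beta;
  lazymatch goal with
  | |- Def (fun e => _ <-> _) => apply Def_equiv; def
  | |- Def (fun e => _ /\ _) => apply Def_and; def
  | |- Def (fun e => _ \/ _) => apply Def_or; def
  | |- Def (fun e => ~ _) => apply Def_not; def
  | |- Def (fun e => exists x, @?P x e) => apply Def_ex; def
  | |- Def (fun e => _ = _) => apply Def_eq; def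
  | |- Def (fun e => _ ∈ _) => apply Def_mem; def
  | |- Def (fun e => forall x : carrier _, _) => apply Def_all; def
  | |- Def (fun e => _ -> _) => apply Def_imp; def
  | |- DefT _ => first [ apply DefT_const | apply DefT_var | assumption | def_hyp | def_user ]
  | |- Def _ => first [ assumption | def_hyp | def_user ]
  end
with def_hyp :=
  match goal with
  | H : DefT (fun e => ?F (e 0) (e 1) (e 2)) |- DefT (fun e => ?F _ _ _) =>
      apply (DefT_app3 F _ _ _ H); def
  | H : DefT (fun e => ?F (e 0) (e 1)) |- DefT (fun e => ?F _ _) =>
      apply (DefT_app2 F _ _ H); def
  | H : DefT (fun e => ?F (e 0)) |- DefT (fun e => ?F _) =>
      apply (DefT_app1 F _ H); def
  | H : Def (fun e => ?F (e 0) (e 1) (e 2)) |- Def (fun e => ?F _ _ _) =>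
      apply (Def_app3 F _ _ _ H); def
  | H : Def (fun e => ?F (e 0) (e 1)) |- Def (fun e => ?F _ _) =>
      apply (Def_app2 F _ _ H); def
  | H : Def (fun e => ?F (e 0)) |- Def (fun e => ?F _) =>
      apply (Def_app1 F _ H); def
  end.

Create HintDb defs.

Ltac def_binder := fail.

Ltac def_user ::=
  match goal with
  | |- Def (fun e => ?P _ _ _) =>
      apply (Def_app3 P); [solve [auto 1 with defs nocore] | def | def | def]
  | |- Def (fun e => ?P _ _) =>
      apply (Def_app2 P); [solve [auto 1 with defs nocore] | def | def]
  | |- Def (fun e => ?P _) =>
      apply (Def_app1 P); [solve [auto 1 with defs nocore] | def]
  | |- DefT (fun e => ?F _ _ _) =>
      apply (DefT_app3 F); [solve [auto 1 with defs nocore] | def | def | def]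
  | |- DefT (fun e => ?F _ _) =>
      apply (DefT_app2 F); [solve [auto 1 with defs nocore] | def | def]
  | |- DefT (fun e => ?F _) =>
      apply (DefT_app1 F); [solve [auto 1 with defs nocore] | def]
  | |- _ => def_binder
  end.

(** * Set constructions inside the model *)

Section ZF.

Context {M : universe} (HZF : is_ZF_model M).

Lemma zf_inhabited : inhabited M.
Proof. destruct (zf_infinity HZF) as [i _]. exact (inhabits i). Qed.

Lemma ext (x y : M) : (forall z, z ∈ x <-> z ∈ y) -> x = y.
Proof. apply zf_extensionality; trivial. Qed.

(** Definite description, with the empty set as junk value. *)
Definition iota (P : M -> Prop) : M :=
  epsilon zf_inhabited (fun v =>
    (P v /\ forall u, P u -> u = v) \/
    (~ (exists w, P w /\ forall u, P u -> u = w) /\ forall x, ~ x ∈ v)).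

Lemma separation (P : M -> Prop) (a : M) :
  Def (fun e => P (e 0)) -> exists b, forall x, x ∈ b <-> x ∈ a /\ P x.
Proof.
  intros HP. destruct (Def_body (fun x _ => P x) HP) as (q & f & H).
  destruct (zf_separation HZF q (fun n => lookup (fun _ => a) (f n)) a) as [b Hb].
  exists b. intros x. rewrite Hb, (H (fun _ => a)). tauto.
Qed.

Lemma iota_cases (P : M -> Prop) :
  (P (iota P) /\ forall u, P u -> u = iota P) \/
  (~ (exists w, P w /\ forall u, P u -> u = w) /\ forall x, ~ x ∈ iota P).
Proof.
  unfold iota. apply epsilon_spec.
  destruct (classic (exists w, P w /\ forall u, P u -> u = w)) as [[w H]|H].
  - exists w. now left.
  - destruct (zf_infinity HZF) as (i & (z & Hz & _) & _). exists z. now right.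
Qed.

Lemma iota_eq (P : M -> Prop) (v : M) : P v -> (forall u, P u -> u = v) -> iota P = v.
Proof.
  intros H1 H2. destruct (iota_cases P) as [[_ H]|[H _]].
  - symmetry. auto.
  - exfalso. apply H. eauto.
Qed.

(** Here metatheoretic choice is seen to be harmless: the predicate handed to [epsilon] has exactly
    one solution, so it is itself the graph of [iota]. The second disjunct fixes the default value
    and keeps this true when the description fails. *)
Lemma DefT_iota (P : M -> (nat -> M) -> Prop) :
  Def (fun e => P (e 0) (shift e)) -> DefT (fun e => iota (fun v => P v e)).
Proof.
  intros HP.
  apply (Def_iff (fun e =>
    (P (e 0) (shift e) /\ forall u, P u (shift e) -> u = e 0) \/
    (~ (exists w, P w (shift e) /\ forall u, P u (shift e) -> u = w) /\
       forall x, ~ x ∈ e 0))).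
  - intros e. split.
    + intros [[H1 H2]|[H1 H2]].
      * symmetry. apply iota_eq; trivial.
      * destruct (iota_cases (fun v => P v (shift e))) as [[H3 H4]|[_ H3]].
        { exfalso. apply H1. eauto. }
        apply ext. intros z. split; intros Hz; [destruct (H2 z Hz)|destruct (H3 z Hz)].
    + intros ->. apply (iota_cases (fun v => P v (shift e))).
  - assert (H1 := Def_drop1 P HP).
    assert (H2 := Def_drop1 (fun x e => P x (shift e)) H1).
    def.
Qed.

(** Empty when [Q] describes a proper class. Being total, set-builder terms can be shown definable
    before the sets are shown to exist. *)
Definition setof (Q : M -> Prop) : M := iota (fun b => forall x, x ∈ b <-> Q x).

Lemma setof_spec (Q : M -> Prop) :
  (exists b, forall x, x ∈ b <-> Q x) -> forall x, x ∈ setof Q <-> Q x.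
Proof.
  intros [b Hb]. unfold setof.
  rewrite (iota_eq (fun b => forall x, x ∈ b <-> Q x) b); trivial.
  intros u Hu. apply ext. intros z. rewrite Hu, Hb. tauto.
Qed.

Lemma DefT_setof (Q : M -> (nat -> M) -> Prop) :
  Def (fun e => Q (e 0) (shift e)) -> DefT (fun e => setof (fun v => Q v e)).
Proof.
  intros HQ. apply DefT_iota.
  assert (H1 := Def_drop1 Q HQ). def.
Qed.

Definition sep (a : M) (P : M -> Prop) : M := setof (fun x => x ∈ a /\ P x).
Definition img (a : M) (F : M -> M) : M := setof (fun y => exists x, x ∈ a /\ y = F x).
Definition emp : M := setof (fun _ => False).
Definition up (x y : M) : M := setof (fun u => u = x \/ u = y).
Definition Un (x : M) : M := setof (fun z => exists y, y ∈ x /\ z ∈ y).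
Definition cup (x y : M) : M := Un (up x y).
Definition succ (x : M) : M := cup x (up x x).
Definition op (x y : M) : M := up (up x x) (up x y).
Definition pr1 (p : M) : M := iota (fun x => exists y, p = op x y).
Definition pr2 (p : M) : M := iota (fun y => exists x, p = op x y).
Definition prod (a b : M) : M := Un (img a (fun x => img b (fun y => op x y))).
Definition lam (a : M) (F : M -> M) : M := img a (fun x => op x (F x)).
Definition ap (f x : M) : M := iota (fun y => op x y ∈ f).
Definition ran (f : M) : M := setof (fun y => exists x, op x y ∈ f).

Ltac def_binder ::=
  match goal with
  | |- DefT (fun e => iota _) => apply DefT_iota; def
  | |- DefT (fun e => setof _) => apply DefT_setof; def
  | |- DefT (fun e => sep _ _) => unfold sep; def
  | |- DefT (fun e => img _ _) => unfold img; def
  | |- DefT (fun e => lam _ _) => unfold lam; def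
  end.

Lemma DefT_up : DefT (fun e => up (e 0) (e 1)).
Proof. unfold up. def. Qed.
Lemma DefT_Un : DefT (fun e => Un (e 0)).
Proof. unfold Un. def. Qed.
Hint Resolve DefT_up DefT_Un : defs.
Lemma DefT_cup : DefT (fun e => cup (e 0) (e 1)).
Proof. unfold cup. def. Qed.
Hint Resolve DefT_cup : defs.
Lemma DefT_succ : DefT (fun e => succ (e 0)).
Proof. unfold succ. def. Qed.
Lemma DefT_op : DefT (fun e => op (e 0) (e 1)).
Proof. unfold op. def. Qed.
Hint Resolve DefT_succ DefT_op : defs.
Lemma DefT_pr1 : DefT (fun e => pr1 (e 0)).
Proof. unfold pr1. def. Qed.
Lemma DefT_pr2 : DefT (fun e => pr2 (e 0)).
Proof. unfold pr2. def. Qed.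
Lemma DefT_prod : DefT (fun e => prod (e 0) (e 1)).
Proof. unfold prod. def. Qed.
Lemma DefT_ap : DefT (fun e => ap (e 0) (e 1)).
Proof. unfold ap. def. Qed.
Lemma DefT_ran : DefT (fun e => ran (e 0)).
Proof. unfold ran. def. Qed.
Hint Resolve DefT_pr1 DefT_pr2 DefT_prod DefT_ap DefT_ran : defs.

Lemma in_sep (a : M) (P : M -> Prop) :
  Def (fun e => P (e 0)) -> forall x, x ∈ sep a P <-> x ∈ a /\ P x.
Proof. intros HP. apply setof_spec, separation, HP. Qed.

Lemma in_img (a : M) (F : M -> M) :
  DefT (fun e => F (e 0)) -> forall y, y ∈ img a F <-> exists x, x ∈ a /\ y = F x.
Proof.
  intros HF. apply setof_spec.
  destruct (Def_body2 (fun x y _ => y = F x)) as (q & f & H). { def. }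
  destruct (zf_replacement HZF q (fun n => lookup (fun _ => a) (f n)) a) as [b Hb].
  - intros x y y' _ H1 H2. rewrite <- H in H1, H2. congruence.
  - exists b. intros y. rewrite Hb.
    split; intros [x H1]; exists x; [rewrite (H (fun _ => a)) | rewrite <- H]; exact H1.
Qed.

Lemma in_emp (x : M) : ~ x ∈ emp.
Proof.
  intros H. apply (setof_spec (fun _ => False)) in H; trivial.
  destruct (zf_infinity HZF) as (i & (z & Hz & _) & _).
  exists z. intros y. split; [apply Hz | tauto].
Qed.

Lemma in_up (x y u : M) : u ∈ up x y <-> u = x \/ u = y.
Proof. revert u. apply setof_spec, zf_pairing, HZF. Qed.

Lemma in_Un (x z : M) : z ∈ Un x <-> exists y, y ∈ x /\ z ∈ y.
Proof. revert z. apply setof_spec, zf_union, HZF. Qed.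

Lemma in_cup (x y z : M) : z ∈ cup x y <-> z ∈ x \/ z ∈ y.
Proof.
  unfold cup. rewrite in_Un. setoid_rewrite in_up.
  split; [intros (u & [-> | ->] & H); auto | intros [H|H]; eauto].
Qed.

Lemma in_succ (x z : M) : z ∈ succ x <-> z ∈ x \/ z = x.
Proof. unfold succ. rewrite in_cup, in_up. tauto. Qed.

Lemma succ_self (x : M) : x ∈ succ x.
Proof. apply in_succ. auto. Qed.

Lemma is_empty_eq (x : M) : is_empty x <-> x = emp.
Proof.
  split; [intros H; apply ext; intros z; split; intros Hz | intros ->; exact in_emp].
  - destruct (H z Hz).
  - destruct (in_emp z Hz).
Qed.

Lemma is_succ_eq (s x : M) : is_succ s x <-> s = succ x.
Proof.
  unfold is_succ. split; [intros H; apply ext | intros -> u]; intros; rewrite ?H, in_succ; tauto.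
Qed.

Lemma is_upair_eq (z x y : M) : is_upair z x y <-> z = up x y.
Proof.
  unfold is_upair. split; [intros H; apply ext | intros -> u]; intros; rewrite ?H, in_up; tauto.
Qed.

Lemma is_opair_eq (p x y : M) : is_opair p x y <-> p = op x y.
Proof.
  unfold is_opair, op. split.
  - intros (s & d & H1 & H2 & H3). apply is_upair_eq in H1, H2, H3. congruence.
  - intros ->. exists (up x x), (up x y). rewrite !is_upair_eq. auto.
Qed.

Lemma up_inj_r (x y y' : M) : up x y = up x y' -> y = y'.
Proof.
  intros H. assert (H1 : y ∈ up x y') by (rewrite <- H; apply in_up; auto).
  assert (H2 : y' ∈ up x y) by (rewrite H; apply in_up; auto).
  apply in_up in H1, H2. destruct H1, H2; congruence.
Qed.

Lemma op_inj (x y x' y' : M) : op x y = op x' y' -> x = x' /\ y = y'.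
Proof.
  unfold op. intros H.
  assert (x = x').
  { assert (H1 : up x x ∈ up (up x' x') (up x' y')) by (rewrite <- H; apply in_up; auto).
    assert (H2 : x' ∈ up x x); [|apply in_up in H2; destruct H2; auto].
    apply in_up in H1. destruct H1 as [H1|H1]; rewrite H1; apply in_up; auto. }
  subst x'. split; trivial. apply up_inj_r in H. now apply up_inj_r in H.
Qed.

Lemma pr1_op (x y : M) : pr1 (op x y) = x.
Proof.
  apply iota_eq; [eauto | intros u [v H]]. apply op_inj in H. destruct H; auto.
Qed.

Lemma pr2_op (x y : M) : pr2 (op x y) = y.
Proof.
  apply iota_eq; [eauto | intros u [v H]]. apply op_inj in H. destruct H; auto.
Qed.

Lemma in_prod (a b p : M) :
  p ∈ prod a b <-> exists x y, x ∈ a /\ y ∈ b /\ p = op x y.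
Proof.
  unfold prod. rewrite in_Un. split.
  - intros (s & H1 & H2). rewrite in_img in H1 by def. destruct H1 as (x & Hx & ->).
    rewrite in_img in H2 by def. destruct H2 as (y & Hy & ->). eauto.
  - intros (x & y & Hx & Hy & ->). exists (img b (fun y => op x y)).
    split; rewrite in_img by def; eauto.
Qed.

Lemma in_prod_op (a b x y : M) : op x y ∈ prod a b <-> x ∈ a /\ y ∈ b.
Proof.
  rewrite in_prod. split; [|intros []; eauto 6].
  intros (x' & y' & Hx & Hy & E). apply op_inj in E. destruct E; subst; auto.
Qed.

Lemma in_lam (a : M) (F : M -> M) (x y : M) :
  DefT (fun e => F (e 0)) -> (op x y ∈ lam a F <-> x ∈ a /\ y = F x).
Proof.
  intros HF. unfold lam. rewrite in_img by def. split.
  - intros (z & Hz & E). apply op_inj in E. destruct E; subst; auto.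
  - intros [H ->]; eauto.
Qed.

Lemma ap_eq (f x y : M) :
  op x y ∈ f -> (forall z, op x z ∈ f -> z = y) -> ap f x = y.
Proof. intros. apply iota_eq; trivial. Qed.

Lemma ap_lam (a : M) (F : M -> M) (x : M) :
  DefT (fun e => F (e 0)) -> x ∈ a -> ap (lam a F) x = F x.
Proof.
  intros HF Hx. apply ap_eq; [|intros z]; rewrite in_lam by trivial; tauto.
Qed.

(** In a recursion the earlier values are passed on as a set of pairs, so functions that agree on
    [a] must give the same set. *)
Lemma lam_ext (a : M) (F G : M -> M) :
  DefT (fun e => F (e 0)) -> DefT (fun e => G (e 0)) ->
  (forall x, x ∈ a -> F x = G x) -> lam a F = lam a G.
Proof.
  intros HF HG E. apply ext. intros z. unfold lam. rewrite !in_img by def.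
  split; intros (x & Hx & ->); exists x; rewrite E by trivial; auto.
Qed.

Lemma in_ran_lam (a : M) (F : M -> M) (y : M) :
  DefT (fun e => F (e 0)) -> (y ∈ ran (lam a F) <-> exists x, x ∈ a /\ y = F x).
Proof.
  intros HF. unfold ran.
  rewrite setof_spec.
  - setoid_rewrite in_lam; tauto.
  - exists (img a F). intros z. rewrite in_img by trivial. setoid_rewrite in_lam; tauto.
Qed.

Lemma mem_irrefl (x : M) : ~ x ∈ x.
Proof.
  intros H. destruct (zf_foundation HZF (up x x)) as (y & Hy & Hm).
  { exists x. apply in_up. auto. }
  apply in_up in Hy. destruct Hy; subst; apply (Hm x); trivial; apply in_up; auto.
Qed.

(** * Functions and bijections as sets of pairs *)

Lemma app_iff (f x y : M) : app f x y <-> op x y ∈ f.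
Proof.
  unfold app. setoid_rewrite is_opair_eq. split; [intros (p & H & ->)|]; eauto.
Qed.

Lemma function_ap (f a b x : M) :
  is_function f a b -> x ∈ a -> app f x (ap f x) /\ ap f x ∈ b.
Proof.
  intros [H1 H2] Hx. destruct (H2 x Hx) as (y & Hy & Hu).
  assert (E : ap f x = y).
  { apply ap_eq; [now apply app_iff|]. intros z Hz. symmetry. now apply Hu, app_iff. }
  rewrite E. split; trivial. destruct Hy as (p & Hp & Ho).
  destruct (H1 p Hp) as (x' & y' & _ & Hy' & Ho'). apply is_opair_eq in Ho, Ho'.
  rewrite Ho in Ho'. apply op_inj in Ho'. destruct Ho' as [_ ->]. trivial.
Qed.

Lemma function_app (f a b x y : M) :
  is_function f a b -> app f x y -> x ∈ a /\ y ∈ b /\ y = ap f x.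
Proof.
  intros Hf Hy. assert (Hx : x ∈ a).
  { destruct Hy as (p & Hp & Ho).
    destruct Hf as [H1 _]. destruct (H1 p Hp) as (x' & y' & Hx' & _ & Ho').
    apply is_opair_eq in Ho, Ho'. rewrite Ho in Ho'. apply op_inj in Ho'.
    destruct Ho' as [-> _]. trivial. }
  destruct (function_ap f a b x Hf Hx) as [H1 H2].
  destruct Hf as [_ H]. destruct (H x Hx) as (v & _ & Hv).
  assert (E : y = ap f x) by (rewrite <- (Hv y), <- (Hv (ap f x)); trivial).
  subst; auto.
Qed.

Lemma app_lam (a : M) (F : M -> M) (x y : M) :
  DefT (fun e => F (e 0)) -> (app (lam a F) x y <-> x ∈ a /\ y = F x).
Proof. intros HF. rewrite app_iff. now apply in_lam. Qed.

Lemma lam_function (a b : M) (F : M -> M) :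
  DefT (fun e => F (e 0)) -> (forall x, x ∈ a -> F x ∈ b) -> is_function (lam a F) a b.
Proof.
  intros HF H. split.
  - unfold lam. intros p. rewrite in_img by def. intros (x & Hx & ->).
    exists x, (F x). rewrite is_opair_eq. auto.
  - intros x Hx. exists (F x). split.
    + apply app_lam; auto.
    + intros y Hy. apply app_lam in Hy; trivial. symmetry. tauto.
Qed.

Lemma lam_bijection (a b : M) (F : M -> M) :
  DefT (fun e => F (e 0)) -> (forall x, x ∈ a -> F x ∈ b) ->
  (forall x x', x ∈ a -> x' ∈ a -> F x = F x' -> x = x') ->
  (forall y, y ∈ b -> exists x, x ∈ a /\ y = F x) ->
  is_bijection (lam a F) a b.
Proof.
  intros HF H1 H2 H3. split; [|split].
  - now apply lam_function.
  - intros x x' y E E'. apply app_lam in E, E'; trivial.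
    destruct E as [Hx ->], E' as [Hx' E]. auto.
  - intros y Hy. destruct (H3 y Hy) as (x & Hx). exists x. now apply app_lam.
Qed.

Definition inv (a : M) (F : M -> M) (y : M) : M := iota (fun x => x ∈ a /\ y = F x).

Lemma DefT_inv (a : (nat -> M) -> M) (F : M -> (nat -> M) -> M) (t : (nat -> M) -> M) :
  DefT a -> DefT (fun e => F (e 0) (shift e)) -> DefT t ->
  DefT (fun e => inv (a e) (fun x => F x e) (t e)).
Proof.
  intros Ha HF Ht. apply DefT_iota.
  apply Def_and; [apply Def_mem; [apply DefT_var | now apply DefT_shift]|].
  apply Def_eq; [now apply DefT_shift | exact HF].
Qed.

Lemma inv_spec (a : M) (F : M -> M) (y : M) :
  (forall x x', x ∈ a -> x' ∈ a -> F x = F x' -> x = x') ->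
  (exists x, x ∈ a /\ y = F x) -> inv a F y ∈ a /\ y = F (inv a F y).
Proof.
  intros H (x & Hx & E).
  replace (inv a F y) with x; auto.
  symmetry. apply iota_eq; auto. intros u [Hu E']. apply H; congruence.
Qed.

Lemma inv_eq (a : M) (F : M -> M) (x : M) :
  (forall x x', x ∈ a -> x' ∈ a -> F x = F x' -> x = x') ->
  x ∈ a -> inv a F (F x) = x.
Proof. intros H Hx. apply iota_eq; auto. intros u [Hu E']. apply H; congruence. Qed.

Lemma inv_bijection (a b : M) (F : M -> M) :
  DefT (fun e => F (e 0)) -> (forall x, x ∈ a -> F x ∈ b) ->
  (forall x x', x ∈ a -> x' ∈ a -> F x = F x' -> x = x') ->
  (forall y, y ∈ b -> exists x, x ∈ a /\ y = F x) ->
  is_bijection (lam b (inv a F)) b a.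
Proof.
  intros HF H1 H2 H3.
  assert (DefT (fun e => inv a F (e 0))) by (apply DefT_inv; def).
  apply lam_bijection; trivial.
  - intros y Hy. apply inv_spec; auto.
  - intros y y' Hy Hy' E.
    destruct (inv_spec a F y), (inv_spec a F y'); auto. congruence.
  - intros x Hx. exists (F x). split; auto. now rewrite inv_eq.
Qed.

Lemma bijection_ap (f a b : M) :
  is_bijection f a b ->
  (forall x, x ∈ a -> ap f x ∈ b) /\
  (forall x x', x ∈ a -> x' ∈ a -> ap f x = ap f x' -> x = x') /\
  (forall y, y ∈ b -> exists x, x ∈ a /\ y = ap f x).
Proof.
  intros (Hf & Hi & Hs). split; [|split].
  - intros x Hx. now apply (function_ap f a b x).
  - intros x x' Hx Hx' E. apply (Hi x x' (ap f x)).
    + now apply (function_ap f a b x).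
    + rewrite E. now apply (function_ap f a b x').
  - intros y Hy. destruct (Hs y Hy) as [x Hx].
    apply (function_app f a b) in Hx; trivial. exists x. tauto.
Qed.

Lemma equinumerous_sym (a b : M) : equinumerous a b -> equinumerous b a.
Proof.
  intros [f Hf]. apply bijection_ap in Hf. destruct Hf as (H1 & H2 & H3).
  exists (lam b (inv a (ap f))). apply inv_bijection; trivial. def.
Qed.

Lemma equinumerous_trans (a b c : M) :
  equinumerous a b -> equinumerous b c -> equinumerous a c.
Proof.
  intros [f Hf] [g Hg]. apply bijection_ap in Hf, Hg.
  destruct Hf as (H1 & H2 & H3), Hg as (G1 & G2 & G3).
  exists (lam a (fun x => ap g (ap f x))). apply lam_bijection; auto.
  - def.
  - intros z Hz. destruct (G3 z Hz) as (y & Hy & ->).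
    destruct (H3 y Hy) as (x & Hx & ->). eauto.
Qed.

(** * Well-founded recursion on a set *)

Section Recursion.

Context (R : M -> M -> Prop) (HR : Def (fun e => R (e 0) (e 1))).
Context (Phi : M -> M -> M -> M) (HPhi : DefT (fun e => Phi (e 0) (e 1) (e 2))).

Definition seg (X x : M) : M := sep X (fun z => R z x).

(** A solution of the recursion on an initial segment [d] of [X]. The parameter [p] is a variable of
    the definition, which makes [rec] definable jointly in [p], [X] and the argument. *)
Definition approximation (p X d g : M) : Prop :=
  (forall y, y ∈ d -> y ∈ X) /\
  (forall y z, y ∈ d -> z ∈ X -> R z y -> z ∈ d) /\
  (forall y, y ∈ d -> ap g y = Phi p y (lam (seg X y) (ap g))).

Definition rec (p X x : M) : M :=
  iota (fun v => exists d g, approximation p X d g /\ x ∈ d /\ v = ap g x).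

Lemma DefT_seg : DefT (fun e => seg (e 0) (e 1)).
Proof. unfold seg. def. Qed.

Lemma DefT_rec : DefT (fun e => rec (e 0) (e 1) (e 2)).
Proof. unfold rec, approximation. assert (H := DefT_seg). def. Qed.

Definition well_founded_on (X : M) : Prop :=
  forall S, (forall x, x ∈ S -> x ∈ X) -> (exists x, x ∈ S) ->
    exists m, m ∈ S /\ forall z, z ∈ S -> ~ R z m.

(** Well-foundedness concerns subsets that are sets of the model; definability of [P] turns its
    counterexamples into such a set. *)
Lemma wf_induction (X : M) (P : M -> Prop) :
  well_founded_on X -> Def (fun e => P (e 0)) ->
  (forall x, x ∈ X -> (forall y, y ∈ X -> R y x -> P y) -> P x) ->
  forall x, x ∈ X -> P x.
Proof.
  intros W HP H x Hx. apply NNPP. intros N.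
  destruct (W (sep X (fun z => ~ P z))) as (m & Hm & Hmin).
  - intros z. rewrite in_sep by def. tauto.
  - exists x. rewrite in_sep by def. auto.
  - rewrite in_sep in Hm by def. destruct Hm as [HmX Hm]. apply Hm, H; trivial.
    intros y Hy Hym. apply NNPP. intros Ny. apply (Hmin y); trivial.
    rewrite in_sep by def. auto.
Qed.

Lemma in_seg (X x z : M) : z ∈ seg X x <-> z ∈ X /\ R z x.
Proof. unfold seg. now rewrite in_sep by def. Qed.

Context (X : M) (W : well_founded_on X).
Context (T : forall x y z, x ∈ X -> y ∈ X -> z ∈ X -> R x y -> R y z -> R x z).

Lemma approximation_unique (p d g d' g' x : M) :
  approximation p X d g -> approximation p X d' g' ->
  x ∈ d -> x ∈ d' -> ap g x = ap g' x.
Proof.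
  intros (A1 & A2 & A3) (B1 & B2 & B3) Hx Hx'.
  assert (HX : x ∈ X) by auto. revert x HX Hx Hx'.
  apply (wf_induction X (fun x => x ∈ d -> x ∈ d' -> ap g x = ap g' x)); trivial.
  { def. }
  intros x HX IH Hx Hx'. rewrite A3, B3 by trivial. f_equal.
  apply lam_ext; try def. intros z Hz. apply in_seg in Hz. destruct Hz.
  apply IH; eauto.
Qed.

Lemma rec_approximation (p d g x : M) :
  approximation p X d g -> x ∈ d -> rec p X x = ap g x.
Proof.
  intros A Hx. apply iota_eq; [eauto|].
  intros u (d' & g' & A' & Hx' & ->). eapply approximation_unique; eauto.
Qed.

Lemma rec_eq (p x : M) : x ∈ X -> rec p X x = Phi p x (lam (seg X x) (rec p X)).
Proof.
  assert (Hrec := DefT_rec). assert (Hseg := DefT_seg).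
  assert (Ex : forall x, x ∈ X -> exists d g, approximation p X d g /\ x ∈ d).
  { apply (wf_induction X (fun x => exists d g, approximation p X d g /\ x ∈ d)); trivial.
    { unfold approximation. def. }
    intros x' Hx' IH.
    set (d := cup (seg X x') (up x' x')).
    (* No gluing of earlier approximations is needed: [rec] already gives their common values, and
       the new approximation is written in terms of it. *)
    set (F := fun y => Phi p y (lam (seg X y) (rec p X))).
    assert (HF : DefT (fun e => F (e 0))) by (unfold F; def).
    assert (Hd : forall z, z ∈ d <-> (z ∈ X /\ R z x') \/ z = x').
    { intros z. unfold d. rewrite in_cup, in_up, in_seg. tauto. }
    assert (Hsub : forall y z, y ∈ d -> z ∈ X -> R z y -> z ∈ X /\ R z x').
    { intros y z Hy Hz Hzy. apply Hd in Hy.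
      destruct Hy as [[Hy1 Hy2]| ->]; eauto. }
    exists d, (lam d F). split; [split; [|split]|].
    - intros y Hy. apply Hd in Hy. destruct Hy as [[]| ->]; trivial.
    - intros y z Hy Hz Hzy. apply Hd. left. eauto.
    - intros y Hy. rewrite ap_lam by trivial. unfold F at 1. f_equal.
      apply lam_ext; try def. intros z Hz. apply in_seg in Hz. destruct Hz as [HzX Hzy].
      destruct (Hsub y z Hy HzX Hzy) as [_ Hzx].
      rewrite ap_lam by (trivial; apply Hd; auto).
      destruct (IH z HzX Hzx) as (dz & gz & A & Hz).
      rewrite (rec_approximation p dz gz z) by trivial.
      assert (A' := A). destruct A' as (A1 & A2 & A3). rewrite A3 by trivial.
      unfold F. f_equal. apply lam_ext; try def. intros w Hw. apply in_seg in Hw.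
      symmetry. apply (rec_approximation p dz gz); trivial. apply (A2 z); tauto.
    - apply Hd. auto. }
  intros Hx. destruct (Ex x Hx) as (d & g & A & Hd).
  rewrite (rec_approximation p d g x) by trivial.
  assert (A' := A). destruct A' as (A1 & A2 & A3). rewrite A3 by trivial.
  f_equal. apply lam_ext; try def. intros w Hw. apply in_seg in Hw.
  symmetry. apply (rec_approximation p d g); trivial. apply (A2 x); tauto.
Qed.

End Recursion.

(** * Ordinals *)

Lemma ordinal_elem (a x : M) : is_ordinal a -> x ∈ a -> is_ordinal x.
Proof.
  intros (Ht & H1 & H2 & H3 & H4) Hx. split; [|split; [|split; [|split]]].
  - intros y Hy z Hz. apply (H2 z y x); trivial; [|apply (Ht x)]; trivial.
    apply (Ht y); trivial. apply (Ht x); trivial.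
  - intros y _. apply mem_irrefl.
  - intros y z t Hy Hz Ht'. apply H2; apply (Ht x); trivial.
  - intros y z Hy Hz. apply H3; apply (Ht x); trivial.
  - intros s Hs. apply H4. intros y Hy. apply (Ht x); auto.
Qed.

Lemma ordinal_trans (a x y : M) : is_ordinal a -> x ∈ y -> y ∈ a -> x ∈ a.
Proof. intros [Ht _] Hx Hy. apply (Ht y); trivial. Qed.

Lemma mem_asym (x y : M) : is_ordinal x -> x ∈ y -> ~ y ∈ x.
Proof. intros Ho H1 H2. apply (mem_irrefl x). exact (ordinal_trans x x y Ho H1 H2). Qed.

Lemma ordinal_sub (a c : M) :
  is_ordinal a -> subset c a -> is_transitive c -> c <> a -> c ∈ a.
Proof.
  intros (Ht & H1 & H2 & H3 & H4) Hc Tc N.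
  destruct (H4 (sep a (fun x => ~ x ∈ c))) as (m & Hm & Hmin).
  - intros x. rewrite in_sep by def. tauto.
  - apply NNPP. intros E. apply N, ext. intros z. split; [apply Hc|].
    intros Hz. apply NNPP. intros Hn. apply E. exists z. rewrite in_sep by def. auto.
  - rewrite in_sep in Hm by def. destruct Hm as [Hma Hm].
    replace c with m; trivial. apply ext. intros x. split; intros Hx.
    + apply NNPP. intros Hn. destruct (Hmin x) as [<-|Hmx].
      * rewrite in_sep by def. split; trivial. apply (Ht m); trivial.
      * now apply mem_irrefl in Hx.
      * apply (mem_irrefl m), (H2 m x m); trivial. apply (Ht m); trivial.
    + destruct (H3 x m) as [H|[->|H]]; trivial; [now apply Hc|tauto|].
      destruct Hm. exact (Tc x Hx m H).
Qed.

Lemma ordinal_le (a b : M) :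
  is_ordinal a -> is_ordinal b -> (subset a b <-> a ∈ b \/ a = b).
Proof.
  intros Ha Hb. split.
  - intros H. destruct (classic (a = b)); auto. left.
    apply ordinal_sub; trivial. apply Ha.
  - intros [H| ->] x Hx; trivial. exact (ordinal_trans b x a Hb Hx H).
Qed.

Lemma trichotomy (a b : M) :
  is_ordinal a -> is_ordinal b -> a ∈ b \/ a = b \/ b ∈ a.
Proof.
  intros Ha Hb. set (c := sep a (fun x => x ∈ b)).
  assert (Hc : forall x, x ∈ c <-> x ∈ a /\ x ∈ b).
  { intros x. unfold c. now rewrite in_sep by def. }
  assert (Tc : is_transitive c).
  { intros x Hx y Hy. apply Hc in Hx. apply Hc. destruct Hx.
    split; eapply ordinal_trans; eauto. }
  destruct (classic (c = a)) as [Ea|Na].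
  { assert (a ∈ b \/ a = b); [|tauto].
    apply ordinal_le; trivial. intros x Hx. rewrite <- Ea in Hx. now apply Hc. }
  destruct (classic (c = b)) as [Eb|Nb].
  { right. assert (b ∈ a \/ b = a); [|intuition].
    apply ordinal_le; trivial. intros x Hx. rewrite <- Eb in Hx. now apply Hc. }
  destruct (mem_irrefl c). apply Hc.
  split; apply ordinal_sub; trivial; intros x Hx; now apply Hc.
Qed.

Lemma not_mem_le (a b : M) :
  is_ordinal a -> is_ordinal b -> ~ a ∈ b -> subset b a.
Proof.
  intros Ha Hb N. apply ordinal_le; trivial. destruct (trichotomy a b) as [|[|]]; auto. tauto.
Qed.

Lemma ordinal_intro (a : M) :
  is_transitive a -> (forall x, x ∈ a -> is_ordinal x) -> is_ordinal a.
Proof.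
  intros Ht H. split; [|split; [|split; [|split]]]; trivial.
  - intros x _. apply mem_irrefl.
  - intros x y z _ _ Hz H1 H2. apply (ordinal_trans z x y); auto.
  - intros x y Hx Hy. apply trichotomy; auto.
  - intros s Hs Hne. destruct (zf_foundation HZF s Hne) as (m & Hm & Hmin).
    exists m. split; trivial. intros x Hx.
    destruct (trichotomy m x) as [|[|]]; auto. now apply Hmin in Hx.
Qed.

Lemma Def_ordinal : Def (fun e : nat -> M => is_ordinal (e 0)).
Proof. unfold is_ordinal, is_transitive, well_ordered_by_mem, subset. def. Qed.
Hint Resolve Def_ordinal : defs.

Lemma Def_subset : Def (fun e : nat -> M => subset (e 0) (e 1)).
Proof. unfold subset. def. Qed.
Hint Resolve Def_subset : defs.

Lemma ordinal_min (P : M -> Prop) (a : M) :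
  Def (fun e => P (e 0)) -> is_ordinal a -> P a ->
  exists m, is_ordinal m /\ P m /\ subset m a /\ forall x, x ∈ m -> ~ P x.
Proof.
  intros HP Ha Pa.
  destruct (classic (exists x, x ∈ a /\ P x)) as [(x & Hx & Px)|N].
  - destruct Ha as (Ht & H1 & H2 & H3 & H4).
    assert (Ha : is_ordinal a) by (repeat split; trivial).
    destruct (H4 (sep a P)) as (m & Hm & Hmin).
    + intros y. rewrite in_sep by def. tauto.
    + exists x. rewrite in_sep by def. auto.
    + rewrite in_sep in Hm by def. destruct Hm as [Hm Pm].
      exists m. split; [|split; [|split]]; trivial.
      * now apply (ordinal_elem a).
      * now apply Ht.
      * intros y Hy Py. destruct (Hmin y) as [<-|E].
        { rewrite in_sep by def. split; trivial. apply (Ht m); trivial. }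
        { now apply mem_irrefl in Hy. }
        { revert E. apply mem_asym; trivial. apply (ordinal_elem a); trivial.
          apply (Ht m); trivial. }
  - exists a. split; [|split; [|split]]; trivial.
    + intros y. trivial.
    + intros y Hy Py. eauto.
Qed.

Lemma ordinal_induction (P : M -> Prop) :
  Def (fun e => P (e 0)) ->
  (forall a, is_ordinal a -> (forall x, x ∈ a -> P x) -> P a) ->
  forall a, is_ordinal a -> P a.
Proof.
  intros HP H a Ha. apply NNPP. intros N.
  destruct (ordinal_min (fun x => ~ P x) a) as (m & Hm & Nm & _ & Hmin); trivial.
  { def. }
  apply Nm, H; trivial. intros x Hx. apply NNPP. exact (Hmin x Hx).
Qed.

Lemma ordinal_succ (a : M) : is_ordinal a -> is_ordinal (succ a).
Proof.
  intros Ha. apply ordinal_intro.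
  - intros x Hx y Hy. apply in_succ in Hx. apply in_succ. left.
    destruct Hx as [Hx| ->]; trivial. exact (ordinal_trans a y x Ha Hy Hx).
  - intros x Hx. apply in_succ in Hx. destruct Hx as [Hx| ->]; trivial.
    now apply (ordinal_elem a).
Qed.

Lemma ordinal_emp : is_ordinal emp.
Proof. apply ordinal_intro; intros x Hx; now apply in_emp in Hx. Qed.

Lemma ordinal_cup (a b : M) :
  is_ordinal a -> is_ordinal b -> (cup a b = a /\ subset b a) \/ (cup a b = b /\ subset a b).
Proof.
  intros Ha Hb.
  assert (subset a b \/ subset b a) as [H|H].
  { destruct (classic (a ∈ b)) as [H|H].
    - left. apply ordinal_le; auto.
    - right. now apply not_mem_le. }
  - right. split; trivial. apply ext. intros z. rewrite in_cup. specialize (H z). tauto.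
  - left. split; trivial. apply ext. intros z. rewrite in_cup. specialize (H z). tauto.
Qed.

Lemma Un_succ (a : M) : is_ordinal a -> Un (succ a) = a.
Proof.
  intros Ha. apply ext. intros z. rewrite in_Un. setoid_rewrite in_succ. split.
  - intros (y & [Hy| ->] & Hz); trivial. exact (ordinal_trans a z y Ha Hz Hy).
  - intros Hz. exists a. auto.
Qed.

Definition ordinals (S : M) : Prop := forall x, x ∈ S -> is_ordinal x.

Lemma mem_well_founded (S : M) : well_founded_on mem S.
Proof. intros s _ Hne. destruct (zf_foundation HZF s Hne) as (m & Hm & H).
  exists m. split; trivial. intros z Hz Hzm. exact (H z Hzm Hz).
Qed.

Lemma mem_trans_on (S x y z : M) :
  ordinals S -> x ∈ S -> y ∈ S -> z ∈ S -> x ∈ y -> y ∈ z -> x ∈ z.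
Proof. intros H _ _ Hz Hx Hy. apply (ordinal_trans z x y); auto. Qed.

Lemma seg_ordinal (a x : M) : is_ordinal a -> x ∈ a -> seg mem a x = x.
Proof.
  intros Ha Hx. apply ext. intros z. rewrite in_seg by def.
  split; [tauto|]. intros Hz. split; trivial. exact (ordinal_trans a z x Ha Hz Hx).
Qed.

(** * Order types *)

Section Collapse.

Context (R : M -> M -> Prop) (HR : Def (fun e => R (e 0) (e 1))).

(** The Mostowski collapse of [R] on [X]. It yields ranks in sets of ordinals and also the coding of
    pairs. *)
Definition col (X x : M) : M := rec R (fun _ _ g => ran g) emp X x.

Lemma DefT_col : DefT (fun e => col (e 0) (e 1)).
Proof.
  unfold col. assert (H : DefT (fun e => rec R (fun _ _ g => ran g) (e 0) (e 1) (e 2))).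
  { apply DefT_rec; def. }
  def.
Qed.

Context (X : M) (W : well_founded_on R X).
Context (T : forall x y z, x ∈ X -> y ∈ X -> z ∈ X -> R x y -> R y z -> R x z).
Context (L : forall x y, x ∈ X -> y ∈ X -> R x y \/ x = y \/ R y x).

Lemma in_col (x z : M) : x ∈ X -> (z ∈ col X x <-> exists y, y ∈ X /\ R y x /\ z = col X y).
Proof.
  intros Hx. assert (Hc := DefT_col). unfold col at 1.
  rewrite rec_eq; trivial; try def.
  change (z ∈ ran (lam (seg R X x) (col X)) <-> exists y, y ∈ X /\ R y x /\ z = col X y).
  rewrite in_ran_lam by def. setoid_rewrite in_seg; trivial.
  split; [intros (y & [] & E) | intros (y & ? & ? & E)]; exists y; auto.
Qed.

Lemma col_ordinal (x : M) : x ∈ X -> is_ordinal (col X x).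
Proof.
  assert (Hc := DefT_col).
  revert x. apply (wf_induction R X (fun x => is_ordinal (col X x))); trivial.
  { def. }
  intros x Hx IH. apply ordinal_intro.
  - intros u Hu v Hv. apply in_col in Hu; trivial. destruct Hu as (y & Hy & Hyx & ->).
    apply in_col in Hv; trivial. destruct Hv as (z & Hz & Hzy & ->).
    apply in_col; trivial. exists z. eauto.
  - intros u Hu. apply in_col in Hu; trivial. destruct Hu as (y & Hy & Hyx & ->). auto.
Qed.

Lemma col_lt (x y : M) : x ∈ X -> y ∈ X -> R x y -> col X x ∈ col X y.
Proof. intros Hx Hy H. apply in_col; eauto. Qed.

Lemma col_inj (x y : M) : x ∈ X -> y ∈ X -> col X x = col X y -> x = y.
Proof.
  intros Hx Hy E. destruct (L x y Hx Hy) as [H|[H|H]]; trivial;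
    apply col_lt in H; trivial; rewrite E in H; now apply mem_irrefl in H.
Qed.

Lemma col_lt_inv (x y : M) : x ∈ X -> y ∈ X -> col X x ∈ col X y -> R x y.
Proof.
  intros Hx Hy E. apply in_col in E; trivial. destruct E as (z & Hz & Hzy & E).
  apply col_inj in E; trivial. now subst.
Qed.

End Collapse.

(** For a set of ordinals [S], [rk] is the position of an element, [ot] the order type and [enum]
    the inverse of [rk]. All three are definable with [S] as a variable, so a whole family of sets
    is enumerated uniformly. *)
Definition rk (S x : M) : M := col mem S x.
Definition ot (S : M) : M := img S (rk S).
Definition enum (S i : M) : M := inv S (rk S) i.

Lemma DefT_rk : DefT (fun e => rk (e 0) (e 1)).
Proof. apply DefT_col. def. Qed.
Hint Resolve DefT_rk : defs.

Lemma DefT_ot : DefT (fun e => ot (e 0)).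
Proof. unfold ot. def. Qed.
Hint Resolve DefT_ot : defs.

Lemma DefT_enum : DefT (fun e => enum (e 0) (e 1)).
Proof. unfold enum. apply DefT_inv; def. Qed.
Hint Resolve DefT_enum : defs.

Section OrderTypeOfOrdinals.

Context (S : M) (HS : ordinals S).

Let T x y z : x ∈ S -> y ∈ S -> z ∈ S -> x ∈ y -> y ∈ z -> x ∈ z :=
  mem_trans_on S x y z HS.
Let L x y (Hx : x ∈ S) (Hy : y ∈ S) : x ∈ y \/ x = y \/ y ∈ x :=
  trichotomy x y (HS x Hx) (HS y Hy).
Let D : Def (fun e : nat -> M => e 0 ∈ e 1) := Def_mem _ _ (DefT_var 0) (DefT_var 1).
Let W := mem_well_founded S.

Lemma rk_inj (x y : M) : x ∈ S -> y ∈ S -> rk S x = rk S y -> x = y.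
Proof. exact (col_inj mem D S W T L x y). Qed.

Lemma in_rk (x z : M) : x ∈ S -> (z ∈ rk S x <-> exists y, y ∈ S /\ y ∈ x /\ z = rk S y).
Proof. exact (in_col mem D S W T x z). Qed.

Lemma rk_ordinal (x : M) : x ∈ S -> is_ordinal (rk S x).
Proof. exact (col_ordinal mem D S W T x). Qed.

Lemma in_ot (z : M) : z ∈ ot S <-> exists x, x ∈ S /\ z = rk S x.
Proof. unfold ot. now rewrite in_img by def. Qed.

Lemma ot_ordinal : is_ordinal (ot S).
Proof.
  apply ordinal_intro.
  - intros u Hu v Hv. apply in_ot in Hu. destruct Hu as (x & Hx & ->).
    apply in_rk in Hv; trivial. destruct Hv as (y & Hy & _ & ->). apply in_ot. eauto.
  - intros u Hu. apply in_ot in Hu. destruct Hu as (x & Hx & ->). now apply rk_ordinal.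
Qed.

Lemma enum_spec (i : M) : i ∈ ot S -> enum S i ∈ S /\ i = rk S (enum S i).
Proof.
  intros Hi. apply inv_spec; [exact rk_inj | now apply in_ot].
Qed.

Lemma enum_rk (x : M) : x ∈ S -> enum S (rk S x) = x.
Proof. apply inv_eq. exact rk_inj. Qed.

Lemma enum_lt (i j : M) : i ∈ ot S -> j ∈ ot S -> i ∈ j -> enum S i ∈ enum S j.
Proof.
  intros Hi Hj Hij. apply enum_spec in Hi, Hj. destruct Hi as [Hi Ei], Hj as [Hj Ej].
  apply (col_lt_inv mem D S W T L); trivial.
  change (rk S (enum S i) ∈ rk S (enum S j)). congruence.
Qed.

Lemma rk_le (x : M) : x ∈ S -> subset (rk S x) x.
Proof.
  revert x. apply (wf_induction mem S (fun x => subset (rk S x) x)); trivial.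
  { unfold subset. def. }
  intros x Hx IH z Hz. apply in_rk in Hz; trivial. destruct Hz as (y & Hy & Hyx & ->).
  assert (rk S y ∈ y \/ rk S y = y) as [H|H].
  { apply ordinal_le; auto using rk_ordinal. }
  - apply (ordinal_trans x (rk S y) y); auto.
  - congruence.
Qed.

Lemma ot_le (a : M) : is_ordinal a -> subset S a -> subset (ot S) a.
Proof.
  intros Ha H z Hz. apply in_ot in Hz. destruct Hz as (x & Hx & ->).
  assert (rk S x ∈ x \/ rk S x = x) as [E|E].
  { apply ordinal_le; auto using rk_ordinal, rk_le. }
  - apply (ordinal_trans a (rk S x) x); auto.
  - rewrite E. auto.
Qed.

Lemma ot_equinumerous : equinumerous S (ot S).
Proof.
  exists (lam S (rk S)). apply lam_bijection.
  - def.
  - intros x Hx. apply in_ot. eauto.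
  - exact rk_inj.
  - intros y Hy. now apply in_ot.
Qed.

End OrderTypeOfOrdinals.

Lemma order_type_of_enumeration (a h : M) (F : M -> M) :
  DefT (fun e => F (e 0)) -> is_ordinal a -> ordinals h ->
  (forall x, x ∈ a -> F x ∈ h) -> (forall y, y ∈ h -> exists x, x ∈ a /\ y = F x) ->
  (forall x x', x ∈ a -> x' ∈ a -> x ∈ x' -> F x ∈ F x') ->
  has_order_type h a.
Proof.
  intros HF Ha Hh H1 H2 H3.
  assert (Hi : forall x x', x ∈ a -> x' ∈ a -> F x = F x' -> x = x').
  { intros x x' Hx Hx' E.
    destruct (trichotomy x x') as [H|[H|H]]; eauto using ordinal_elem;
      apply H3 in H; trivial; rewrite E in H; now apply mem_irrefl in H. }
  split; trivial. exists (lam h (inv a F)). split; [now apply inv_bijection|].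
  assert (HI : DefT (fun e => inv a F (e 0))) by (apply DefT_inv; def).
  intros x x' y y' E E'. apply app_lam in E, E'; trivial.
  destruct E as [Hx ->], E' as [Hx' ->].
  destruct (inv_spec a F x) as [Hy Ey], (inv_spec a F x') as [Hy' Ey']; auto.
  split; intros H.
  - destruct (trichotomy (inv a F x) (inv a F x')) as [C|[C|C]];
      eauto using ordinal_elem; exfalso.
    + rewrite <- C, <- Ey in Ey'. subst x'. now apply mem_irrefl in H.
    + apply H3 in C; trivial. rewrite <- Ey, <- Ey' in C. revert C. apply mem_asym; auto.
  - rewrite Ey, Ey'. auto.
Qed.

Lemma initial_part (S k : M) :
  ordinals S -> is_ordinal k -> ~ ot S ∈ k ->
  exists h, subset h S /\ has_order_type h k.
Proof.
  intros HS Hk N. assert (Hsub : subset k (ot S)).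
  { apply not_mem_le; trivial. now apply ot_ordinal. }
  assert (E : forall y, y ∈ img k (enum S) <-> exists x, x ∈ k /\ y = enum S x).
  { intros y. now rewrite in_img by def. }
  assert (Hh : subset (img k (enum S)) S).
  { intros y Hy. apply E in Hy. destruct Hy as (x & Hx & ->). apply enum_spec; auto. }
  exists (img k (enum S)). split; trivial.
  apply (order_type_of_enumeration k _ (enum S)); trivial.
  - def.
  - intros y Hy. auto.
  - intros x Hx. apply E. eauto.
  - intros y Hy. now apply E.
  - intros x x' Hx Hx'. apply enum_lt; auto.
Qed.

Lemma order_type_equinumerous (h a : M) : has_order_type h a -> equinumerous h a.
Proof. intros (_ & f & Hf & _). now exists f. Qed.

(** * Cardinality *)

(** [g] need not be a function on [a]: [ap g x] is then [emp]. *)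
Definition cov (a b : M) : Prop := exists g, forall y, y ∈ b -> exists x, x ∈ a /\ y = ap g x.

Lemma Def_cov : Def (fun e => cov (e 0) (e 1)).
Proof. unfold cov. def. Qed.
Hint Resolve Def_cov : defs.

Lemma cov_intro (a b : M) (F : M -> M) :
  DefT (fun e => F (e 0)) -> (forall y, y ∈ b -> exists x, x ∈ a /\ y = F x) -> cov a b.
Proof.
  intros HF H. exists (lam a F). intros y Hy. destruct (H y Hy) as (x & Hx & ->).
  exists x. now rewrite ap_lam.
Qed.

Lemma cov_trans (a b c : M) : cov a b -> cov b c -> cov a c.
Proof.
  intros [f Hf] [g Hg]. apply (cov_intro a c (fun x => ap g (ap f x))). { def. }
  intros z Hz. destruct (Hg z Hz) as (y & Hy & ->). destruct (Hf y Hy) as (x & Hx & ->). eauto.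
Qed.

Lemma cov_sub (a b : M) : subset b a -> cov a b.
Proof. intros H. apply (cov_intro a b (fun x => x)); [def|]. intros y Hy. eauto. Qed.

Lemma cov_prod (a b : M) : cov a b -> cov (prod a a) (prod b b).
Proof.
  intros [g Hg].
  apply (cov_intro _ _ (fun p => op (ap g (pr1 p)) (ap g (pr2 p)))). { def. }
  intros p Hp. apply in_prod in Hp. destruct Hp as (x & y & Hx & Hy & ->).
  destruct (Hg x Hx) as (x' & Hx' & ->), (Hg y Hy) as (y' & Hy' & ->).
  exists (op x' y'). rewrite in_prod_op, pr1_op, pr2_op. auto.
Qed.

Lemma equinumerous_cov (a b : M) : equinumerous a b -> cov a b.
Proof. intros [f Hf]. apply bijection_ap in Hf. exists f. apply Hf. Qed.

(** Since [a] is an ordinal, least preimages turn a covering into an injection of [k] into [a]. Its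
    image has order type at most [a], so [k] would be equinumerous with a smaller ordinal. *)
Lemma cardinal_not_cov (k a : M) : is_cardinal k -> a ∈ k -> ~ cov a k.
Proof.
  intros [Hk Hc] Ha [g Hg]. assert (Oa := ordinal_elem k a Hk Ha).
  set (least := fun y => iota (fun x => (x ∈ a /\ y = ap g x) /\
                                forall z, z ∈ a /\ y = ap g z -> subset x z)).
  assert (HD : DefT (fun e => least (e 0))) by (unfold least; def).
  assert (HL : forall y, y ∈ k -> least y ∈ a /\ y = ap g (least y)).
  { intros y Hy. destruct (Hg y Hy) as (x & Hx & E).
    destruct (ordinal_min (fun x => x ∈ a /\ y = ap g x) x)
      as (m & Om & Hm & _ & Hmin); eauto using ordinal_elem.
    { def. }
    assert (HE : forall z, z ∈ a /\ y = ap g z -> subset m z).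
    { intros z [Hz Ez]. apply not_mem_le; eauto using ordinal_elem.
      intros Hzm. apply (Hmin z); auto. }
    replace (least y) with m; trivial. symmetry. apply iota_eq; auto.
    intros u [Hu1 Hu2]. apply ext. intros z. split; [apply Hu2 | apply HE]; trivial. }
  set (S := img k least).
  assert (InS : forall z, z ∈ S <-> exists y, y ∈ k /\ z = least y).
  { intros z. unfold S. now rewrite in_img by def. }
  assert (HSa : subset S a).
  { intros z Hz. apply InS in Hz. destruct Hz as (y & Hy & ->). now apply HL. }
  assert (HS : ordinals S) by (intros z Hz; eauto using ordinal_elem).
  assert (E : equinumerous k S).
  { exists (lam k least). apply lam_bijection; trivial.
    - intros y Hy. apply InS. eauto.
    - intros y y' Hy Hy' E. apply HL in Hy, Hy'. destruct Hy as [_ Hy], Hy' as [_ Hy'].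
      congruence.
    - intros z Hz. now apply InS. }
  assert (E' := equinumerous_trans _ _ _ E (ot_equinumerous S HS)).
  apply (Hc (ot S)); [|now apply equinumerous_sym].
  assert (Oot := ot_ordinal S HS).
  assert (ot S ∈ a \/ ot S = a) as [H| ->]; trivial.
  { apply ordinal_le; trivial. now apply ot_le. }
  exact (ordinal_trans k (ot S) a Hk H Ha).
Qed.

Lemma Def_equinumerous : Def (fun e : nat -> M => equinumerous (e 0) (e 1)).
Proof.
  assert (H : Def (fun e : nat -> M => app (e 0) (e 1) (e 2))).
  { apply (Def_iff (fun e => op (e 1) (e 2) ∈ e 0)); [|def].
    intros e. symmetry. apply app_iff. }
  assert (H' : Def (fun e : nat -> M => is_opair (e 0) (e 1) (e 2))).
  { apply (Def_iff (fun e => e 0 = op (e 1) (e 2))); [|def].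
    intros e. symmetry. apply is_opair_eq. }
  unfold equinumerous, is_bijection, is_function, unique. def.
Qed.
Hint Resolve Def_equinumerous : defs.

Lemma cardinality (S : M) :
  ordinals S ->
  exists c, has_card S c /\ forall b, is_ordinal b -> equinumerous S b -> subset c b.
Proof.
  intros HS.
  destruct (ordinal_min (equinumerous S) (ot S)) as (c & Oc & Hc & _ & Hmin).
  { def. } { now apply ot_ordinal. } { now apply ot_equinumerous. }
  exists c. split.
  - split; trivial. split; trivial. intros b Hb E.
    apply (Hmin b Hb). apply (equinumerous_trans _ c); trivial. now apply equinumerous_sym.
  - intros b Hb E. apply not_mem_le; trivial. intros H. exact (Hmin b H E).
Qed.

Lemma equinumerous_refl (a : M) : equinumerous a a.
Proof. exists (lam a (fun x => x)). apply lam_bijection; eauto. def. Qed.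

(** * Gödel's well-order of pairs *)

(** The larger coordinate, as the union of two ordinals is their maximum. *)
Definition mx (p : M) : M := cup (pr1 p) (pr2 p).

Definition godel_lt (p q : M) : Prop :=
  mx p ∈ mx q \/ (mx p = mx q /\
    (pr1 p ∈ pr1 q \/ (pr1 p = pr1 q /\ pr2 p ∈ pr2 q))).

Lemma DefT_mx : DefT (fun e => mx (e 0)).
Proof. unfold mx. def. Qed.
Hint Resolve DefT_mx : defs.

Lemma Def_godel_lt : Def (fun e => godel_lt (e 0) (e 1)).
Proof. unfold godel_lt. def. Qed.
Hint Resolve Def_godel_lt : defs.

Section Godel.

Context (k : M) (Hk : is_ordinal k).

Lemma in_square (p : M) :
  p ∈ prod k k -> pr1 p ∈ k /\ pr2 p ∈ k /\ p = op (pr1 p) (pr2 p) /\ mx p ∈ k.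
Proof.
  intros Hp. apply in_prod in Hp. destruct Hp as (x & y & Hx & Hy & ->).
  unfold mx. rewrite pr1_op, pr2_op. repeat split; trivial.
  destruct (ordinal_cup x y) as [[-> _]|[-> _]]; eauto using ordinal_elem.
Qed.

Lemma square_ordinal (p : M) :
  p ∈ prod k k -> is_ordinal (pr1 p) /\ is_ordinal (pr2 p) /\ is_ordinal (mx p).
Proof.
  intros Hp. apply in_square in Hp.
  split; [|split]; apply (ordinal_elem k); tauto.
Qed.

Lemma pr_le_mx (p : M) : subset (pr1 p) (mx p) /\ subset (pr2 p) (mx p).
Proof. unfold mx. split; intros x Hx; apply in_cup; auto. Qed.

Lemma godel_trans (p q r : M) :
  p ∈ prod k k -> q ∈ prod k k -> r ∈ prod k k ->
  godel_lt p q -> godel_lt q r -> godel_lt p r.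
Proof.
  intros _ _ Hr. apply square_ordinal in Hr. destruct Hr as (O1 & O2 & O3).
  unfold godel_lt.
  intros [H|[E [H|[E1 H]]]] [H'|[E' [H'|[E1' H']]]];
    rewrite ?E, ?E', ?E1, ?E1' in *; eauto 6 using ordinal_trans.
Qed.

Lemma godel_total (p q : M) :
  p ∈ prod k k -> q ∈ prod k k -> godel_lt p q \/ p = q \/ godel_lt q p.
Proof.
  intros Hp Hq.
  destruct (in_square p Hp) as (_ & _ & Ep & _), (in_square q Hq) as (_ & _ & Eq & _).
  apply square_ordinal in Hp, Hq.
  destruct Hp as (O1 & O2 & O3), Hq as (O1' & O2' & O3'). unfold godel_lt.
  destruct (trichotomy (mx p) (mx q)) as [H|[H|H]]; auto.
  destruct (trichotomy (pr1 p) (pr1 q)) as [H1|[H1|H1]]; auto 10.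
  destruct (trichotomy (pr2 p) (pr2 q)) as [H2|[H2|H2]]; auto 10.
  right. left. congruence.
Qed.

Lemma godel_well_founded : well_founded_on godel_lt (prod k k).
Proof.
  intros S HS [p Hp].
  (* Minimise in turn the maximum, the first coordinate and the second coordinate. *)
  destruct (ordinal_min (fun a => exists p, p ∈ S /\ mx p = a) (mx p))
    as (m & Om & (p1 & Hp1 & E1) & _ & Min1); eauto.
  { def. } { apply square_ordinal; auto. }
  destruct (ordinal_min (fun a => exists p, p ∈ S /\ mx p = m /\ pr1 p = a) (pr1 p1))
    as (m1 & Om1 & (p2 & Hp2 & E2 & E3) & _ & Min2); eauto.
  { def. } { apply square_ordinal; auto. }
  destruct (ordinal_min (fun a => exists p, p ∈ S /\ mx p = m /\ pr1 p = m1 /\ pr2 p = a)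
    (pr2 p2)) as (m2 & Om2 & (p3 & Hp3 & E4 & E5 & E6) & _ & Min3); eauto 6.
  { def. } { apply square_ordinal; auto. }
  exists p3. split; trivial. intros z Hz. unfold godel_lt. rewrite E4, E5, E6.
  intros [H|[E [H|[E' H]]]]; [apply Min1 in H | apply Min2 in H | apply Min3 in H];
    eauto 6.
Qed.

Definition code (p : M) : M := col godel_lt (prod k k) p.

Lemma DefT_code : DefT (fun e => code (e 0)).
Proof. unfold code. assert (H := DefT_col godel_lt Def_godel_lt). def. Qed.

Lemma in_code (p z : M) :
  p ∈ prod k k -> (z ∈ code p <-> exists q, q ∈ prod k k /\ godel_lt q p /\ z = code q).
Proof. exact (in_col _ Def_godel_lt _ godel_well_founded godel_trans p z). Qed.

Lemma code_ordinal (p : M) : p ∈ prod k k -> is_ordinal (code p).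
Proof. exact (col_ordinal _ Def_godel_lt _ godel_well_founded godel_trans p). Qed.

Lemma code_inj (p q : M) : p ∈ prod k k -> q ∈ prod k k -> code p = code q -> p = q.
Proof.
  exact (col_inj _ Def_godel_lt _ godel_well_founded godel_trans godel_total p q).
Qed.

(** For [b] below [pr1 p], the pair [(b, 0)] has maximum [b] and so precedes [p]; by induction [b]
    is at most the code of [(b, 0)], which is below [code p]. This bound later ensures that a
    recursion along codes calls only earlier values. *)
Lemma le_code (p : M) : p ∈ prod k k -> subset (pr1 p) (code p).
Proof.
  intros Hp. assert (Hc := DefT_code).
  assert (H : forall a, is_ordinal a ->
    forall p, p ∈ prod k k -> pr1 p = a -> subset a (code p)).
  { apply (ordinal_induction (fun a =>
      forall p, p ∈ prod k k -> pr1 p = a -> subset a (code p))).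
    { def. }
    clear p Hp. intros a Ha IH p Hp E b Hb.
    destruct (in_square p Hp) as (H1 & _ & _ & _). rewrite E in H1.
    assert (Hbk : b ∈ k) by exact (ordinal_trans k b a Hk Hb H1).
    assert (H0 : emp ∈ k).
    { destruct (trichotomy emp k ordinal_emp Hk) as [H|[H|H]]; trivial.
      - rewrite <- H in Hbk. now apply in_emp in Hbk.
      - now apply in_emp in H. }
    assert (Hq : op b emp ∈ prod k k) by (apply in_prod_op; auto).
    assert (Hlt : code (op b emp) ∈ code p).
    { apply in_code; trivial. exists (op b emp). split; [|split]; trivial.
      left. unfold mx at 1. rewrite pr1_op, pr2_op.
      replace (cup b emp) with b. { apply (proj1 (pr_le_mx p)). now rewrite E. }
      apply ext. intros z. rewrite in_cup. assert (N := in_emp z). tauto. }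
    assert (Hle : subset b (code (op b emp))).
    { apply IH; trivial. apply pr1_op. }
    apply ordinal_le in Hle; eauto using ordinal_elem, code_ordinal.
    destruct Hle as [Hle| ->]; trivial.
    apply (ordinal_trans (code p) b (code (op b emp))); auto using code_ordinal. }
  apply H; trivial. apply square_ordinal; trivial.
Qed.

(** These conditions isolate what [ω] and [ω1] have in common: smaller squares are finite in the
    first case and countable in the second. *)
Context (Hsucc : forall a, a ∈ k -> succ a ∈ k).
Context (Hsmall : forall a, a ∈ k -> ~ cov (prod a a) k).

(** Both coordinates of a predecessor of [p] are at most [mx p]. If [code p] reached [k], the square
    of [succ (mx p)] would therefore cover [k]. *)
Lemma code_bound (p : M) : p ∈ prod k k -> code p ∈ k.
Proof.
  intros Hp. assert (Hc := DefT_code). apply NNPP. intros N.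
  assert (Hsub : subset k (code p)) by (apply not_mem_le; trivial; now apply code_ordinal).
  destruct (in_square p Hp) as (_ & _ & _ & Hm).
  apply (Hsmall (succ (mx p)) (Hsucc _ Hm)).
  apply (cov_intro _ _ code); trivial. intros y Hy. apply Hsub in Hy.
  apply in_code in Hy; trivial. destruct Hy as (q & Hq & Hqp & ->).
  exists q. split; trivial.
  destruct (square_ordinal q Hq) as (O1 & O2 & O3).
  destruct (square_ordinal p Hp) as (_ & _ & O).
  assert (Hle : subset (mx q) (mx p)).
  { apply ordinal_le; trivial. destruct Hqp as [|[? _]]; auto. }
  assert (HH : forall x, is_ordinal x -> subset x (mx q) -> x ∈ succ (mx p)).
  { intros x Ox Hx. apply in_succ. apply ordinal_le; trivial. intros z Hz. auto. }
  destruct (in_square q Hq) as (_ & _ & -> & _). apply in_prod_op.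
  split; apply HH; trivial; apply pr_le_mx.
Qed.

Lemma pairing_functions :
  exists l r : M -> M,
    DefT (fun e => l (e 0)) /\ DefT (fun e => r (e 0)) /\
    forall a b, a ∈ k -> b ∈ k ->
      exists c, c ∈ k /\ subset a c /\ l c = a /\ r c = b.
Proof.
  assert (Hc := DefT_code).
  set (d := inv (prod k k) code).
  assert (Hd : DefT (fun e => d (e 0))) by (apply DefT_inv; def).
  exists (fun c => pr1 (d c)), (fun c => pr2 (d c)). split; [def|split; [def|]].
  intros a b Ha Hb. assert (Hp : op a b ∈ prod k k) by (apply in_prod_op; auto).
  assert (E : d (code (op a b)) = op a b) by (apply inv_eq; trivial; exact code_inj).
  exists (code (op a b)). rewrite E, pr1_op, pr2_op.
  split; [|split; [|auto]].
  - now apply code_bound.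
  - rewrite <- (pr1_op a b) at 1. now apply le_code.
Qed.

End Godel.

(** * The first uncountable cardinals *)

Section Omega.

Context (w : M) (Hw : is_omega w).

Lemma omega_ordinal : is_ordinal w.
Proof. apply Hw. Qed.

Lemma omega_emp : emp ∈ w.
Proof.
  destruct Hw as ((Ho & Hne & _) & _).
  destruct (trichotomy emp w ordinal_emp Ho) as [H|[H|H]]; trivial.
  - destruct Hne. now apply is_empty_eq.
  - now apply in_emp in H.
Qed.

Lemma omega_succ (n : M) : n ∈ w -> succ n ∈ w.
Proof.
  intros Hn. destruct Hw as ((Ho & _ & Hns) & _).
  assert (On := ordinal_elem w n Ho Hn).
  destruct (trichotomy (succ n) w (ordinal_succ n On) Ho) as [H|[H|H]]; trivial.
  - destruct Hns. exists n. now apply is_succ_eq.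
  - apply in_succ in H. destruct H as [H|H].
    + now apply (mem_asym n w) in H.
    + rewrite H in Hn. now apply mem_irrefl in Hn.
Qed.

Lemma omega_induction (P : M -> Prop) :
  Def (fun e => P (e 0)) -> P emp -> (forall n, n ∈ w -> P n -> P (succ n)) ->
  forall n, n ∈ w -> P n.
Proof.
  intros HP H0 HS n Hn. apply NNPP. intros N.
  destruct (ordinal_min (fun x => x ∈ w /\ ~ P x) n) as (m & Om & [Hm Nm] & _ & Min).
  { def. } { exact (ordinal_elem w n omega_ordinal Hn). } { auto. }
  destruct Hw as (_ & Hl). apply (Hl m Hm). split; [|split]; trivial.
  - intros E. apply is_empty_eq in E. congruence.
  - intros [b E]. apply is_succ_eq in E. subst m.
    assert (Hb : b ∈ w) by exact (ordinal_trans w b _ omega_ordinal (succ_self b) Hm).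
    apply Nm, HS; trivial. apply NNPP. intros Nb. apply (Min b); auto using succ_self.
Qed.

(** Finiteness in the form: every partial function into [w] is bounded. *)
Definition bfin (s : M) : Prop :=
  forall g, exists m, m ∈ w /\ forall x, x ∈ s -> ap g x ∈ w -> ap g x ∈ m.

Lemma Def_bfin : Def (fun e => bfin (e 0)).
Proof. unfold bfin. def. Qed.
Hint Resolve Def_bfin : defs.

Lemma bfin_cov (a b : M) : cov a b -> bfin a -> bfin b.
Proof.
  intros [f Hf] Ha g. destruct (Ha (lam a (fun x => ap g (ap f x)))) as (m & Hm & H).
  exists m. split; trivial. intros y Hy Hyw. destruct (Hf y Hy) as (x & Hx & ->).
  specialize (H x Hx). rewrite ap_lam in H by (trivial; def). auto.
Qed.

Lemma bfin_cup (a b : M) : bfin a -> bfin b -> bfin (cup a b).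
Proof.
  intros Ha Hb g. destruct (Ha g) as (m & Hm & H), (Hb g) as (m' & Hm' & H').
  exists (cup m m'). split.
  - destruct (ordinal_cup m m') as [[-> _]|[-> _]]; trivial;
      eapply ordinal_elem; eauto using omega_ordinal.
  - intros x Hx Hxw. apply in_cup. apply in_cup in Hx. destruct Hx; auto.
Qed.

Lemma bfin_emp : bfin emp.
Proof.
  intros g. exists emp. split; [exact omega_emp|]. intros x Hx. now apply in_emp in Hx.
Qed.

Lemma bfin_singleton (x : M) : bfin (up x x).
Proof.
  intros g. destruct (classic (ap g x ∈ w)) as [H|H].
  - exists (succ (ap g x)). split; [now apply omega_succ|].
    intros y Hy _. apply in_up in Hy. assert (y = x) as -> by tauto. apply succ_self.
  - exists emp. split; [exact omega_emp|].
    intros y Hy Hyw. apply in_up in Hy. assert (y = x) as -> by tauto. tauto.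
Qed.

Lemma bfin_nat (n : M) : n ∈ w -> bfin n.
Proof.
  revert n. apply (omega_induction bfin); [def | exact bfin_emp |].
  intros n _ H. apply bfin_cup; trivial. apply bfin_singleton.
Qed.

Lemma bfin_square (n : M) : n ∈ w -> bfin (prod n n).
Proof.
  intros Hn.
  (* The factors must vary separately: [prod (succ m) n] is [prod m n] together with one copy of
     [n]. *)
  assert (H : forall m, m ∈ w -> bfin (prod m n)).
  { apply (omega_induction (fun m => bfin (prod m n))). { def. }
    - apply (bfin_cov emp); [|exact bfin_emp].
      apply cov_sub. intros p Hp. apply in_prod in Hp.
      destruct Hp as (x & y & Hx & _). now apply in_emp in Hx.
    - intros m Hm IH. apply (bfin_cov (cup (prod m n) (prod (up m m) n))).
      + apply cov_sub. intros p Hp. apply in_prod in Hp.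
        destruct Hp as (x & y & Hx & Hy & ->). rewrite in_cup, !in_prod_op, in_up.
        apply in_succ in Hx. tauto.
      + apply bfin_cup; trivial. apply (bfin_cov n); [|now apply bfin_nat].
        apply (cov_intro _ _ (fun x => op m x)). { def. }
        intros p Hp. apply in_prod in Hp. destruct Hp as (x & y & Hx & Hy & ->).
        exists y. apply in_up in Hx. split; trivial. f_equal. tauto. }
  auto.
Qed.

(** A covering of [w] would take its own bound [m] as a value, whence [m ∈ m]. *)
Lemma bfin_not_cov (s : M) : bfin s -> ~ cov s w.
Proof.
  intros H [g Hg]. destruct (H g) as (m & Hm & Hb).
  destruct (Hg m Hm) as (x & Hx & E).
  apply (mem_irrefl m). rewrite E at 1. apply Hb; trivial. congruence.
Qed.

Lemma omega_square : cov w (prod w w).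
Proof.
  destruct (pairing_functions w omega_ordinal omega_succ) as (l & r & Hl & Hr & H).
  { intros a Ha. apply bfin_not_cov. now apply bfin_square. }
  apply (cov_intro _ _ (fun c => op (l c) (r c))). { def. }
  intros p Hp. apply in_prod in Hp. destruct Hp as (x & y & Hx & Hy & ->).
  destruct (H x y Hx Hy) as (c & Hc & _ & El & Er). exists c. split; congruence.
Qed.

(** * Countable ordinals, pairing on [ω1], hulls and branches *)

Context (w1 : M) (Hw1 : is_next_cardinal w1 w).

Lemma omega1_ordinal : is_ordinal w1.
Proof. apply Hw1. Qed.

(** The cardinality of [a] is at most [a]; if it exceeded [w], it would be a cardinal strictly
    between [w] and [w1]. *)
Lemma omega1_countable (a : M) : a ∈ w1 -> cov w a.
Proof.
  intros Ha. destruct Hw1 as (Hc1 & _ & Hn).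
  assert (Oa := ordinal_elem w1 a omega1_ordinal Ha).
  destruct (cardinality a) as (c & [Hc E] & Hmin).
  { intros x Hx. exact (ordinal_elem a x Oa Hx). }
  assert (Oc : is_ordinal c) by apply Hc.
  apply (cov_trans w c a).
  - apply cov_sub, not_mem_le; trivial. { exact omega_ordinal. }
    intros Hwc. apply (Hn c); trivial.
    destruct (proj1 (ordinal_le c a Oc Oa)) as [H| ->]; trivial.
    + apply Hmin; trivial. apply equinumerous_refl.
    + exact (ordinal_trans w1 c a omega1_ordinal H Ha).
  - now apply equinumerous_cov, equinumerous_sym.
Qed.

(** Hilbert's hotel: if [w1 = succ n] then [n] covers [succ n]. *)
Lemma omega1_succ (n : M) : n ∈ w1 -> succ n ∈ w1.
Proof.
  intros Hn. assert (Ho := omega1_ordinal). assert (On := ordinal_elem w1 n Ho Hn).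
  destruct (trichotomy (succ n) w1 (ordinal_succ n On) Ho) as [H|[E|H]]; trivial; exfalso.
  - apply (cardinal_not_cov w1 n); trivial. { apply Hw1. }
    assert (Hwn : subset w n).
    { apply ordinal_le; trivial. { exact omega_ordinal. }
      apply in_succ. rewrite E. apply Hw1. }
    rewrite <- E.
    (* [Un] is the predecessor on successors: 0 goes to [n], the other finite ordinals move down by
       one, and infinite ones stay fixed. *)
    set (F := fun x => iota (fun v => (x = emp /\ v = n) \/
      (x ∈ w /\ x <> emp /\ v = Un x) \/ (~ x ∈ w /\ v = x))).
    apply (cov_intro _ _ F). { unfold F. def. }
    assert (H0 := omega_emp).
    intros y Hy. apply in_succ in Hy. destruct Hy as [Hy| ->].
    + destruct (classic (y ∈ w)) as [Hyw|Hyw].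
      * exists (succ y). split. { apply Hwn. now apply omega_succ. }
        assert (succ y <> emp).
        { intros E'. apply (in_emp y). rewrite <- E'. apply succ_self. }
        assert (Un (succ y) = y) by (apply Un_succ; exact (ordinal_elem n y On Hy)).
        assert (succ y ∈ w) by now apply omega_succ.
        symmetry. apply iota_eq; [right; left; auto|]. intros u Hu. intuition congruence.
      * exists y. split; trivial. symmetry. apply iota_eq; [tauto|].
        intros u Hu. assert (y <> emp) by congruence. tauto.
    + exists emp. split; [auto|]. symmetry. apply iota_eq; [tauto|].
      intros u Hu. tauto.
  - apply in_succ in H. destruct H as [H|H].
    + now apply (mem_asym n w1) in H.
    + rewrite H in Hn. now apply mem_irrefl in Hn.
Qed.

Lemma omega1_pairing :
  exists l r : M -> M,
    DefT (fun e => l (e 0)) /\ DefT (fun e => r (e 0)) /\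
    forall a b, a ∈ w1 -> b ∈ w1 ->
      exists c, c ∈ w1 /\ subset a c /\ l c = a /\ r c = b.
Proof.
  apply pairing_functions; auto using omega1_ordinal, omega1_succ.
  intros a Ha Hcov. apply (cardinal_not_cov w1 w); try apply Hw1.
  apply (cov_trans w (prod w w)); [exact omega_square|].
  apply (cov_trans _ (prod a a)); trivial.
  now apply cov_prod, omega1_countable.
Qed.

(** With a pairing [c = (l c, r c)] on [w1] such that [l c <= c], the equation
    [h (c + 1) = F (h (l c)) (r c)] is a legitimate transfinite recursion. *)
Lemma hull (F : M -> M -> M) (n0 : M) :
  DefT (fun e => F (e 0) (e 1)) ->
  exists h : M -> M,
    DefT (fun e => h (e 0)) /\ h emp = n0 /\
    forall c i, c ∈ w1 -> i ∈ w1 -> exists d, d ∈ w1 /\ h d = F (h c) i.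
Proof.
  intros HF. destruct omega1_pairing as (l & r & Hl & Hr & Hp).
  assert (Ho := omega1_ordinal).
  (* The second clause is meant for successors, where [Un c] is the predecessor. At a limit [Un c]
     is [c] and some further node appears; extra nodes do no harm, because a hull is used only
     through its base node, its closure and its indexing by [w1]. *)
  set (Phi := fun _ c g : M => iota (fun v => (c = emp /\ v = n0) \/
    (c <> emp /\ v = F (ap g (l (Un c))) (r (Un c))))).
  assert (HPhi : DefT (fun e => Phi (e 0) (e 1) (e 2))) by (unfold Phi; def).
  assert (HR : Def (fun e : nat -> M => e 0 ∈ e 1)) by def.
  set (h := rec mem Phi emp w1).
  assert (Hh : DefT (fun e => h (e 0))).
  { unfold h. assert (H := DefT_rec mem HR Phi HPhi). def. }
  assert (Eh : forall c, c ∈ w1 -> h c = Phi emp c (lam c h)).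
  { intros c Hc. unfold h at 1. rewrite rec_eq; trivial.
    - rewrite seg_ordinal; trivial.
    - apply mem_well_founded.
    - intros x y z Hx Hy Hz. apply (mem_trans_on w1); trivial.
      intros t Ht. exact (ordinal_elem w1 t Ho Ht). }
  exists h. split; [|split]; trivial.
  - rewrite Eh.
    + apply iota_eq; [auto|]. intros u Hu. tauto.
    + exact (ordinal_trans w1 emp w Ho omega_emp (proj1 (proj2 Hw1))).
  - intros c i Hc Hi. destruct (Hp c i Hc Hi) as (d & Hd & Hcd & El & Er).
    assert (Od := ordinal_elem w1 d Ho Hd).
    (* The code [d] may equal [c], so the value is placed one step later, where [h c] is already
       available. *)
    exists (succ d). split; [now apply omega1_succ|].
    rewrite Eh by now apply omega1_succ.
    assert (N : succ d <> emp).
    { intros E. apply (in_emp d). rewrite <- E. apply succ_self. }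
    assert (E : ap (lam (succ d) h) (l (Un (succ d))) = h c).
    { rewrite Un_succ, El by trivial. apply ap_lam; trivial.
      apply in_succ, ordinal_le; trivial. exact (ordinal_elem w1 c Ho Hc). }
    unfold Phi. rewrite E, Un_succ, Er by trivial.
    apply iota_eq; [auto|]. intros u Hu. tauto.
Qed.

(** Taking least ordinals replaces dependent choice. The node at level [n] is recovered as
    [img n k], so [T (img n k) (k n)] relates each new element to all earlier ones at once. *)
Lemma branch (Q : M -> Prop) (T : M -> M -> Prop) :
  Def (fun e => Q (e 0)) -> Def (fun e => T (e 0) (e 1)) -> Q emp ->
  (forall s, Q s -> exists x, is_ordinal x /\ T s x /\ Q (cup s (up x x))) ->
  exists k : M -> M,
    DefT (fun e => k (e 0)) /\
    forall n, n ∈ w -> Q (img n k) /\ T (img n k) (k n).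
Proof.
  intros HQ HT Q0 QS. assert (Ho := omega_ordinal).
  set (P := fun s x => T s x /\ Q (cup s (up x x))).
  set (next := fun s => iota (fun x => is_ordinal x /\ P s x /\ forall y, y ∈ x -> ~ P s y)).
  assert (HP : Def (fun e => P (e 0) (e 1))) by (unfold P; def).
  assert (Hnext : DefT (fun e => next (e 0))) by (unfold next; def).
  assert (Enext : forall s, Q s -> P s (next s)).
  { intros s Hs. destruct (QS s Hs) as (x & Ox & Hx).
    destruct (ordinal_min (P s) x) as (m & Om & Hm & _ & Min); trivial.
    { def. }
    replace (next s) with m; trivial. symmetry. apply iota_eq; auto.
    intros u (Ou & Hu & Minu). destruct (trichotomy u m) as [H|[H|H]]; trivial.
    - destruct (Min u H Hu).
    - destruct (Minu m H Hm). }
  assert (HR : Def (fun e : nat -> M => e 0 ∈ e 1)) by def.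
  assert (HPhi : DefT (fun e => (fun _ _ g => next (ran g)) (e 0) (e 1) (e 2))) by def.
  set (k := rec mem (fun _ _ g => next (ran g)) emp w).
  assert (Hk : DefT (fun e => k (e 0))).
  { unfold k. assert (H := DefT_rec mem HR _ HPhi). def. }
  assert (Ek : forall n, n ∈ w -> k n = next (img n k)).
  { intros n Hn. unfold k at 1. rewrite rec_eq; trivial.
    - rewrite seg_ordinal by trivial. f_equal.
      apply ext. intros z. rewrite in_ran_lam, in_img by trivial. reflexivity.
    - apply mem_well_founded.
    - intros x y z Hx Hy Hz. apply (mem_trans_on w); trivial.
      intros t Ht. exact (ordinal_elem w t Ho Ht). }
  assert (HQk : forall n, n ∈ w -> Q (img n k)).
  { apply (omega_induction (fun n => Q (img n k))). { def. }
    - replace (img emp k) with emp; trivial. apply ext. intros z.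
      rewrite in_img by trivial. split; [intros H; now apply in_emp in H|].
      intros (x & H & _). now apply in_emp in H.
    - intros n Hn IH. replace (img (succ n) k) with (cup (img n k) (up (k n) (k n))).
      + rewrite Ek at 1 2 by trivial. now apply Enext.
      + apply ext. intros z. rewrite in_cup, in_up, !in_img by trivial.
        setoid_rewrite in_succ. split.
        * intros [(x & Hx & ->)|H]; [eauto|]. exists n. tauto.
        * intros (x & [Hx| ->] & ->); eauto. }
  exists k. split; trivial. intros n Hn. split; auto.
  rewrite (Ek n) by trivial. apply Enext; auto.
Qed.

(** * The four properties of [ω2] *)

Context (w2 : M) (Hw2 : is_next_cardinal w2 w1).

Lemma omega2_ordinal : is_ordinal w2.
Proof. apply Hw2. Qed.

Lemma omega2_elem (x : M) : x ∈ w2 -> is_ordinal x.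
Proof. apply ordinal_elem, omega2_ordinal. Qed.

Lemma omega2_not_cov : ~ cov w1 w2.
Proof. apply cardinal_not_cov; apply Hw2. Qed.

Lemma omega2_not_union (D : M -> M) :
  DefT (fun e => D (e 0)) ->
  (forall c, c ∈ w1 -> ordinals (D c) /\ ot (D c) ∈ w1) ->
  exists x, x ∈ w2 /\ forall c, c ∈ w1 -> ~ x ∈ D c.
Proof.
  intros HD H. apply NNPP. intros N. apply omega2_not_cov.
  destruct omega1_pairing as (l & r & Hl & Hr & Hp).
  apply (cov_intro _ _ (fun c => enum (D (l c)) (r c))). { def. }
  intros x Hx. assert (Ex : exists c, c ∈ w1 /\ x ∈ D c).
  { apply NNPP. intros N'. apply N. exists x. split; trivial.
    intros c Hc Hxc. eauto. }
  destruct Ex as (c & Hc & Hxc). destruct (H c Hc) as [Oc Hot].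
  destruct (Hp c (rk (D c) x)) as (d & Hd & _ & El & Er); trivial.
  { apply (ordinal_trans w1 _ (ot (D c)) omega1_ordinal); trivial.
    apply in_ot; eauto. }
  exists d. split; trivial. rewrite El, Er, enum_rk; trivial.
Qed.

Lemma omega2_arrow1 : arrow1 w2 w1 w1.
Proof.
  intros f Hf. set (D := fun c => sep w2 (fun x => ap f x = c)).
  assert (HD : DefT (fun e => D (e 0))) by (unfold D; def).
  assert (InD : forall c x, x ∈ D c <-> x ∈ w2 /\ ap f x = c).
  { intros c x. unfold D. now rewrite in_sep by def. }
  assert (OD : forall c, ordinals (D c)).
  { intros c x Hx. apply omega2_elem. now apply InD in Hx. }
  destruct (classic (exists c, ~ ot (D c) ∈ w1)) as [[c Hc]|N].
  - destruct (initial_part (D c) w1) as (h & Hh & Ht); trivial.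
    { exact omega1_ordinal. }
    exists h. split; [|split].
    + intros x Hx. apply Hh, InD in Hx. tauto.
    + split; [apply Hw1|]. now apply order_type_equinumerous.
    + exists c. intros x Hx. apply Hh, InD in Hx. destruct Hx as [Hx <-].
      now apply (function_ap f w2 w1).
  - exfalso. destruct (omega2_not_union D) as (x & Hx & Nx); trivial.
    { intros c _. split; trivial. apply NNPP. eauto. }
    apply (Nx (ap f x)); [|now apply InD]. now apply (function_ap f w2 w1).
Qed.

Lemma omega2_regressive : Regressive w2 w1.
Proof.
  intros f [Hf Hreg]. set (D := fun c => sep w2 (fun x => ap f x = c)).
  assert (HD : DefT (fun e => D (e 0))) by (unfold D; def).
  assert (InD : forall c x, x ∈ D c <-> x ∈ w2 /\ ap f x = c).
  { intros c x. unfold D. now rewrite in_sep by def. }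
  assert (OD : forall c, ordinals (D c)).
  { intros c x Hx. apply omega2_elem. now apply InD in Hx. }
  assert (Ho1 := omega1_ordinal).
  destruct (classic (exists c, c ∈ w2 /\ ~ ot (D c) ∈ w1)) as [(c & Hc & Nc)|N].
  - destruct (cardinality (D c)) as (k & Hk & _); trivial.
    exists c, (D c), k. split; [|split; [|split]]; trivial.
    + intros x. rewrite InD. split.
      * intros [Hx <-]. now apply (function_ap f w2 w2).
      * intros Hx. apply (function_app f w2 w2) in Hx; trivial.
        destruct Hx as (Hx & _ & ->). auto.
    + destruct Hk as [Hk E]. apply ordinal_le; trivial. { apply Hk. }
      apply not_mem_le; trivial. { apply Hk. }
      intros Hk1. apply (cardinal_not_cov w1 k); trivial. { apply Hw1. }
      destruct (initial_part (D c) w1) as (h & Hh & Ht); trivial.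
      apply (cov_trans _ (D c)). { now apply equinumerous_cov, equinumerous_sym. }
      apply (cov_trans _ h). { now apply cov_sub. }
      now apply equinumerous_cov, order_type_equinumerous.
  - exfalso. destruct (hull (fun c i => enum (D c) i) emp) as (h & Hh & E0 & Hc).
    { def. }
    assert (Ex : exists x, x ∈ w2 /\ ~ exists c, c ∈ w1 /\ x = h c).
    { apply NNPP. intros N'. apply omega2_not_cov.
      apply (cov_intro _ _ h); trivial. intros x Hx. apply NNPP. eauto. }
    destruct Ex as (x0 & Hx0 & Nx0).
    destruct (ordinal_min (fun x => x ∈ w2 /\ ~ exists c, c ∈ w1 /\ x = h c) x0)
      as (x & Ox & [Hx Nx] & _ & Min); auto using omega2_elem.
    { def. }
    (* A regressive function is unconstrained at 0, which is why the hull starts from the node 0. *)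
    assert (Hne : ~ is_empty x).
    { intros E. apply is_empty_eq in E. apply Nx. exists emp. split; [|congruence].
      exact (ordinal_trans w1 emp w Ho1 omega_emp (proj1 (proj2 Hw1))). }
    destruct (function_ap f w2 w2 x Hf Hx) as [Hap Hy].
    (* By minimality of [x] the smaller ordinal [ap f x] is a node. Every element of its fiber has
       an index below [w1] and is thus a node too, in particular [x]. *)
    assert (Hlt := Hreg x _ Hx Hne Hap).
    assert (Ey : exists c, c ∈ w1 /\ ap f x = h c).
    { apply NNPP. intros Ny. apply (Min (ap f x)); auto. }
    destruct Ey as (c & Hcw & Ec).
    assert (Hot : ot (D (h c)) ∈ w1).
    { apply NNPP. intros Nc. apply N. exists (h c). split; congruence. }
    assert (HxD : x ∈ D (h c)) by now apply InD.
    destruct (Hc c (rk (D (h c)) x)) as (d & Hd & Ed); trivial.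
    { apply (ordinal_trans w1 _ (ot (D (h c)))); trivial. apply in_ot; eauto. }
    apply Nx. exists d. split; trivial. rewrite Ed. symmetry. now apply enum_rk.
Qed.

(** Decide the ordinals below [w2] in increasing order, accepting [x] when it is admissible for [s]
    and compatible with everything accepted before. Read forwards, the equivalence makes members of
    [D s] pairwise compatible; read backwards, a rejected admissible [x] has a conflict with an
    earlier member. *)
Lemma greedy (A : M -> M -> Prop) (C : M -> M -> M -> Prop) :
  Def (fun e => A (e 0) (e 1)) -> Def (fun e => C (e 0) (e 1) (e 2)) ->
  exists D : M -> M,
    DefT (fun e => D (e 0)) /\
    forall s x, x ∈ D s <->
      x ∈ w2 /\ A s x /\ forall y, y ∈ x -> y ∈ D s -> C s y x.
Proof.
  intros HA HC. assert (Ho := omega2_ordinal).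
  set (P := fun s x g => A s x /\ forall y, y ∈ x -> emp ∈ ap g y -> C s y x).
  assert (HP : Def (fun e => P (e 0) (e 1) (e 2))) by (unfold P; def).
  (* The recursion computes truth values, coded as subsets of [{∅}]: [emp] belongs to the value
     exactly when [x] is accepted. *)
  set (Phi := fun s x g => sep (succ emp) (fun _ => P s x g)).
  assert (HPhi : DefT (fun e => Phi (e 0) (e 1) (e 2))) by (unfold Phi; def).
  assert (HR : Def (fun e : nat -> M => e 0 ∈ e 1)) by def.
  set (ch := fun s x => rec mem Phi s w2 x).
  assert (Hch : DefT (fun e => ch (e 0) (e 1))).
  { unfold ch. assert (H := DefT_rec mem HR Phi HPhi). def. }
  assert (Ech : forall s x, x ∈ w2 -> (emp ∈ ch s x <-> P s x (lam x (ch s)))).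
  { intros s x Hx. unfold ch at 1. rewrite rec_eq; trivial.
    - rewrite seg_ordinal by trivial. unfold Phi at 1. rewrite in_sep by def.
      split; [tauto|]. split; trivial. apply succ_self.
    - apply mem_well_founded.
    - intros u v z Hu Hv Hz. apply (mem_trans_on w2); trivial. exact omega2_elem. }
  exists (fun s => sep w2 (fun x => emp ∈ ch s x)). split; [def|].
  intros s x. rewrite in_sep by def.
  split; intros [Hx H]; split; trivial; [apply Ech in H | apply Ech]; trivial;
    destruct H as [HAx H]; split; trivial; intros y Hy Hys;
    assert (Hyw := ordinal_trans w2 y x Ho Hy Hx); apply H; trivial.
  - rewrite ap_lam by (trivial; def). rewrite in_sep in Hys by def. tauto.
  - rewrite ap_lam in Hys by (trivial; def). rewrite in_sep by def. auto.
Qed.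

Lemma up_comm (x y : M) : up x y = up y x.
Proof. apply ext. intros z. rewrite !in_up. tauto. Qed.

(** [D s] is a greedy 0-homogeneous set among the points that lie above [s] and
    are joined by colour 1 to all of [s].  A point outside [D s] for all [s] in
    a hull extends every such [s] below it, hence produces an infinite branch. *)
Lemma omega2_arrow2 (w' : M) : is_succ w' w -> arrow2 w2 w1 w'.
Proof.
  intros Hw' zero one two pairs f Hzero Hone Htwo Hpairs Hf.
  apply is_succ_eq in Hw', Hone, Htwo.
  assert (Ho := omega2_ordinal).
  set (J := fun x y => op (up x y) one ∈ f).
  assert (HJ : Def (fun e => J (e 0) (e 1))) by (unfold J; def).
  assert (Jsym : forall x y, J x y -> J y x).
  { intros x y. unfold J. now rewrite (up_comm x y). }
  set (A := fun s x => forall y, y ∈ s -> y ∈ x /\ J y x).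
  assert (HA : Def (fun e => A (e 0) (e 1))) by (unfold A; def).
  destruct (greedy A (fun s y x => ~ J y x)) as (D & HD & InD). { def. } { def. }
  assert (OD : forall s, ordinals (D s)).
  { intros s x Hx. apply omega2_elem. now apply InD in Hx. }
  destruct (classic (exists s, ~ ot (D s) ∈ w1)) as [[s Hs]|N].
  - left. destruct (initial_part (D s) w1) as (h & Hh & Ht); trivial.
    { exact omega1_ordinal. }
    assert (Hsub : subset h w2).
    { intros x Hx. apply Hh, InD in Hx. tauto. }
    exists h. split; [|split]; trivial.
    intros z (a & b & Ha & Hb & Nab & Ez).
    assert (Hz : z ∈ pairs) by (apply Hpairs; exists a, b; auto).
    apply is_upair_eq in Ez. subst z.
    assert (NJ : ~ J a b).
    { destruct (trichotomy a b) as [H|[H|H]]; eauto using omega2_elem.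
      - apply Hh, InD in Hb. apply Hb; auto.
      - intros HJ'. apply Jsym in HJ'. apply Hh, InD in Ha. revert HJ'. apply Ha; auto. }
    destruct (function_ap f pairs two (up a b) Hf Hz) as [Hap Hv].
    rewrite Htwo in Hv. apply in_succ in Hv. destruct Hv as [Hv|Hv].
    + rewrite Hone in Hv. apply in_succ in Hv. destruct Hv as [Hv|Hv].
      * destruct (Hzero _ Hv).
      * now rewrite Hv in Hap.
    + rewrite Hv in Hap. apply app_iff in Hap. contradiction.
  - right.
    destruct (hull (fun s i => cup s (up (enum (D s) i) (enum (D s) i))) emp)
      as (h & Hh & E0 & Hc). { def. }
    destruct (omega2_not_union (fun c => D (h c))) as (x & Hx & Nx). { def. }
    { intros c _. split; trivial. apply NNPP. eauto. }
    destruct (branch (fun s => (exists c, c ∈ w1 /\ s = h c) /\ A s x)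
                     (fun s y => y ∈ x /\ J y x /\ A s y)) as (k & Hk & Bk).
    { def. } { def. }
    { split.
      - exists emp. split; auto.
        exact (ordinal_trans w1 emp w omega1_ordinal omega_emp (proj1 (proj2 Hw1))).
      - intros y Hy. now apply in_emp in Hy. }
    { intros s [(c & Hcw & ->) HAx].
      (* [x] is admissible for the node but not in [D (h c)], so it was rejected on account of a
         smaller member joined to it by colour 1. *)
      assert (Ex : exists y, y ∈ x /\ y ∈ D (h c) /\ J y x).
      { apply NNPP. intros N'. apply (Nx c Hcw). apply InD. split; [|split]; trivial.
        intros y Hy Hys HJy. eauto. }
      destruct Ex as (y & Hyx & HyD & HJy).
      exists y. split; [exact (OD _ _ HyD)|].
      split; [split; [|split]; trivial; now apply InD in HyD|]. split.
      - destruct (Hc c (rk (D (h c)) y)) as (d & Hd & Ed); trivial.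
        { apply (ordinal_trans w1 _ (ot (D (h c)))); [exact omega1_ordinal| |].
          - apply in_ot; eauto.
          - apply NNPP. eauto. }
        exists d. rewrite Ed, enum_rk by trivial. auto.
      - intros z Hz. apply in_cup in Hz. rewrite in_up in Hz.
        destruct Hz as [Hz|Hz]; auto. assert (z = y) as -> by tauto. auto. }
    assert (Kx : forall n, n ∈ w -> k n ∈ x /\ J (k n) x).
    { intros n Hn. destruct (Bk n Hn) as (_ & ? & ? & _). auto. }
    assert (Kn : forall m n, m ∈ n -> n ∈ w -> k m ∈ k n /\ J (k m) (k n)).
    { intros m n Hmn Hn. destruct (Bk n Hn) as (_ & _ & _ & H). apply H.
      rewrite in_img by trivial. eauto. }
    assert (Ow := omega_ordinal).
    (* An enumeration of length [ω + 1]: the branch, with [x] on top at place [w]. *)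
    set (E := fun n => iota (fun v => (n ∈ w /\ v = k n) \/ (~ n ∈ w /\ v = x))).
    assert (HE : DefT (fun e => E (e 0))) by (unfold E; def).
    assert (E1 : forall n, n ∈ w -> E n = k n).
    { intros n Hn. apply iota_eq; [auto|]. intros u Hu. tauto. }
    assert (E2 : E w = x).
    { assert (Nw := mem_irrefl w). apply iota_eq; [auto|]. intros u Hu. tauto. }
    set (H := img w' E).
    assert (InH : forall y, y ∈ H <-> (exists n, n ∈ w /\ y = k n) \/ y = x).
    { intros y. unfold H. rewrite in_img by trivial. rewrite Hw'.
      setoid_rewrite in_succ. split.
      - intros (n & [Hn| ->] & ->); [left; exists n|]; auto.
      - intros [(n & Hn & ->)| ->]; [exists n; rewrite E1 | exists w; rewrite E2]; auto. }
    assert (HH : subset H w2).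
    { intros y Hy. apply InH in Hy. destruct Hy as [(n & Hn & ->)| ->]; trivial.
      apply (ordinal_trans w2 _ x); trivial. now apply Kx. }
    assert (HEH : forall n, n ∈ w' -> E n ∈ H).
    { intros n Hn. unfold H. rewrite in_img by trivial. eauto. }
    exists H. split; [|split]; trivial.
    + apply (order_type_of_enumeration w' H E); trivial.
      * rewrite Hw'. now apply ordinal_succ.
      * intros y Hy. apply omega2_elem. auto.
      * intros y Hy. unfold H in Hy. now rewrite in_img in Hy by trivial.
      * intros m n Hm Hn Hmn. rewrite Hw' in Hm, Hn. apply in_succ in Hm, Hn.
        destruct Hn as [Hn| ->].
        { assert (Hm' := ordinal_trans w m n Ow Hmn Hn).
          rewrite !E1 by trivial. now apply Kn. }
        { rewrite E2, E1 by trivial. now apply Kx. }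
    + intros z (a & b & Ha & Hb & Nab & Ez). apply is_upair_eq in Ez. subst z.
      apply app_iff. fold (J a b). apply InH in Ha, Hb.
      destruct Ha as [(m & Hm & ->)| ->], Hb as [(n & Hn & ->)| ->]; try tauto.
      * destruct (trichotomy m n) as [C|[C|C]]; eauto using ordinal_elem.
        { now apply Kn. } { congruence. } { now apply Jsym, Kn. }
      * now apply Kx.
      * now apply Jsym, Kx.
Qed.

Lemma omega_unique (v : M) : is_omega v -> v = w.
Proof.
  intros [Hv Lv]. destruct Hw as [Hl Ll].
  destruct (trichotomy v w) as [H|[H|H]]; trivial; try apply Hv; try apply Hl.
  - destruct (Ll v H Hv).
  - destruct (Lv w H Hl).
Qed.

(** [D s] is a greedy family with kernel [s].  A set outside [D s] for all [s] in
    a hull would contain an infinite increasing union of nodes [s]. *)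
Lemma omega2_delta : arrow_delta w2 w1.
Proof.
  intros F HF [_ [f Hf]]. apply bijection_ap in Hf. destruct Hf as (Hf1 & Hf2 & Hf3).
  (* The family indexed by [w2], so that greedy selection and order types can be applied to the
     indices. *)
  set (a := inv F (ap f)).
  assert (Ha : DefT (fun e => a (e 0))) by (apply DefT_inv; def).
  assert (Ha1 : forall x, x ∈ w2 -> a x ∈ F /\ x = ap f (a x)).
  { intros x Hx. apply inv_spec; auto. }
  assert (Oa : forall x, x ∈ w2 -> ordinals (a x)).
  { intros x Hx. destruct (Ha1 x Hx) as [H _]. exact (proj2 (HF _ H)). }
  assert (Fin : forall x, x ∈ w2 -> exists n, n ∈ w /\ cov n (a x)).
  { intros x Hx. destruct (Ha1 x Hx) as [H _]. destruct (HF _ H) as [(v & n & Hv & Hn & E) _].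
    apply omega_unique in Hv. subst v. exists n. split; trivial.
    now apply equinumerous_cov, equinumerous_sym. }
  assert (Ho1 := omega1_ordinal).
  assert (Hota : forall x, x ∈ w2 -> ot (a x) ∈ w1).
  { intros x Hx. apply NNPP. intros N. destruct (Fin x Hx) as (n & Hn & Hcov).
    apply (cardinal_not_cov w1 n). { apply Hw1. }
    { apply (ordinal_trans w1 n w); trivial. apply Hw1. }
    apply (cov_trans _ (a x)); trivial.
    apply (cov_trans _ (ot (a x))). { now apply equinumerous_cov, ot_equinumerous, Oa. }
    apply cov_sub, not_mem_le; trivial. now apply ot_ordinal, Oa. }
  destruct (greedy (fun s x => subset s (a x))
                   (fun s y x => forall z, z ∈ a y -> z ∈ a x -> z ∈ s)) as (D & HD & InD).
  { def. } { def. }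
  assert (OD : forall s, ordinals (D s)).
  { intros s x Hx. apply omega2_elem. now apply InD in Hx. }
  destruct (classic (exists s, ~ ot (D s) ∈ w1)) as [[s Hs]|N].
  - destruct (initial_part (D s) w1) as (h & Hh & Ht); trivial.
    assert (InB : forall b, b ∈ img h a <-> exists x, x ∈ h /\ b = a x).
    { intros b. now rewrite in_img by trivial. }
    assert (Hhw : subset h w2).
    { intros x Hx. apply Hh, InD in Hx. tauto. }
    exists (img h a). split; [|split].
    + intros b Hb. apply InB in Hb. destruct Hb as (x & Hx & ->). apply Ha1; auto.
    (* The kernel is [s]: every selected set contains it, and a later one meets an earlier one only
       inside it. *)
    + exists s. intros b b' Hb Hb' Nbb z. apply InB in Hb, Hb'.
      destruct Hb as (x & Hx & ->), Hb' as (y & Hy & ->).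
      assert (Dx := Hh x Hx). assert (Dy := Hh y Hy). apply InD in Dx, Dy.
      destruct Dx as (Hx2 & Sx & Cx), Dy as (Hy2 & Sy & Cy).
      split; [auto|]. intros [Hzx Hzy].
      destruct (trichotomy x y) as [H|[H|H]]; auto using omega2_elem.
      * apply (Cy x); auto.
      * congruence.
      * apply (Cx y); auto.
    + split; [apply Hw1|]. apply (equinumerous_trans _ h).
      * apply equinumerous_sym. exists (lam h a). apply lam_bijection; trivial.
        { intros x Hx. apply InB. eauto. }
        { intros x y Hx Hy E. destruct (Ha1 x), (Ha1 y); auto. congruence. }
        { intros b Hb. now apply InB. }
      * now apply order_type_equinumerous.
  - exfalso. destruct omega1_pairing as (l & r & Hl & Hr & Hp).
    (* The index [i] codes two choices: [l i] picks a member [y] of [D s], and [r i] an element of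
       the finite set [a y]. *)
    destruct (hull (fun s i => cup s (up (enum (a (enum (D s) (l i))) (r i))
                                         (enum (a (enum (D s) (l i))) (r i)))) emp)
      as (h & Hh & E0 & Hc). { def. }
    destruct (omega2_not_union (fun c => D (h c))) as (x & Hx & Nx). { def. }
    { intros c _. split; trivial. apply NNPP. eauto. }
    destruct (branch (fun s => (exists c, c ∈ w1 /\ s = h c) /\ subset s (a x))
                     (fun s z => z ∈ a x /\ ~ z ∈ s)) as (k & Hk & Bk).
    { def. } { def. }
    { split.
      - exists emp. split; auto.
        exact (ordinal_trans w1 emp w Ho1 omega_emp (proj1 (proj2 Hw1))).
      - intros y Hy. now apply in_emp in Hy. }
    { intros s [(c & Hcw & ->) HAx].
      (* Rejection of [x] means that [a x] meets some earlier [a y] outside the node; a common point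
         [z] extends the node within [a x]. *)
      assert (Ex : exists y z, y ∈ D (h c) /\ z ∈ a y /\ z ∈ a x /\ ~ z ∈ h c).
      { apply NNPP. intros N'. apply (Nx c Hcw). apply InD. split; [|split]; trivial.
        intros y Hy Hys z Hzy Hzx. apply NNPP. intros Nz. apply N'. eauto 6. }
      destruct Ex as (y & z & HyD & Hzy & Hzx & Nz).
      assert (Hy : y ∈ w2) by now apply InD in HyD.
      exists z. split; [exact (Oa x Hx z Hzx)|]. split; auto. split.
      - destruct (Hp (rk (D (h c)) y) (rk (a y) z)) as (i & Hi & _ & El & Er).
        { apply (ordinal_trans w1 _ (ot (D (h c)))); trivial.
          - apply in_ot; eauto.
          - apply NNPP. eauto. }
        { apply (ordinal_trans w1 _ (ot (a y))); auto. apply in_ot; eauto. }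
        destruct (Hc c i) as (d & Hd & Ed); trivial.
        exists d. split; trivial. rewrite Ed, El, Er.
        rewrite (enum_rk (D (h c))), (enum_rk (a y)) by auto. reflexivity.
      - intros v Hv. apply in_cup in Hv. rewrite in_up in Hv.
        destruct Hv as [Hv|Hv]; auto. assert (v = z) as -> by tauto. trivial. }
    assert (Ki : forall m n, m ∈ n -> n ∈ w -> k m <> k n).
    { intros m n Hmn Hn E. destruct (Bk n Hn) as (_ & _ & NK). apply NK.
      rewrite <- E, in_img by trivial. eauto. }
    (* The injective sequence [k] runs inside the finite set [a x]; inverting it would let a natural
       number cover [w]. *)
    destruct (Fin x Hx) as (n & Hn & Hcov).
    apply (bfin_not_cov n). { now apply bfin_nat. }
    apply (cov_trans _ (a x)); trivial.
    apply (cov_intro _ _ (inv w k)). { apply DefT_inv; def. }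
    intros m Hm. exists (k m). split; [now apply Bk|]. symmetry. apply inv_eq; trivial.
    intros i j Hi Hj E.
    assert (Ow := omega_ordinal).
    destruct (trichotomy i j) as [H|[H|H]]; eauto using ordinal_elem; exfalso.
    + exact (Ki i j H Hj E).
    + exact (Ki j i H Hi (eq_sym E)).
Qed.

End Omega.

(** [is_omega1] and [is_omega2] each bring their own witnesses for the smaller cardinals, and these
    have to be identified. *)
Lemma next_cardinal_unique (k l l' : M) :
  is_next_cardinal l k -> is_next_cardinal l' k -> l = l'.
Proof.
  intros (H1 & H2 & H3) (H1' & H2' & H3').
  destruct (trichotomy l l') as [H|[H|H]]; trivial; try apply H1; try apply H1'.
  - destruct (H3' l H H2 H1).
  - destruct (H3 l' H H2' H1').
Qed.

End ZF.

Theorem corollary1p4 (M : universe) (HZF : is_ZF_model M)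
    (w w' w1 w2 : M)
    (Hw : is_omega w) (Hw' : is_succ w' w)
    (Hw1 : is_omega1 w1) (Hw2 : is_omega2 w2) :
  arrow1 w2 w1 w1 /\
  arrow2 w2 w1 w' /\
  Regressive w2 w1 /\
  arrow_delta w2 w1.
Proof.
  destruct Hw1 as (v & Hv & H1), Hw2 as (v1 & (v' & Hv' & H1') & H2).
  apply (omega_unique HZF w Hw) in Hv, Hv'. subst v v'.
  assert (v1 = w1) as -> by exact (next_cardinal_unique HZF w v1 w1 H1' H1).
  split; [|split; [|split]].
  - now apply (omega2_arrow1 HZF w Hw).
  - now apply (omega2_arrow2 HZF w Hw).
  - now apply (omega2_regressive HZF w Hw).
  - now apply (omega2_delta HZF w Hw).
Qed.
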